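(* Let $S:\Omega=\Omega(u,v)$ be a solution in $E^4$ of the Betchov-Da Rios equation $\Omega_v=\Omega_u\times\Omega_{uu}\times\Omega_{uuu}$ whose $u$-parameter curves are unit speed, with ED$^2$-frame field $\{T,E,D,N\}$ and associated functions $\kappa,\sigma,\tau$ (notation and standing assumptions as in the context). Let $$a_{23}=\frac{-1}{\tau\kappa^2}\Big(-3\kappa^3\tau\sigma\sigma_u+\kappa^5\tau_u+2\kappa^4\tau\kappa_u-2\tau\kappa_u^3-\kappa^2\sigma^2(3\kappa\tau_u+5\tau\kappa_u)+2\kappa\kappa_u(\kappa_u\tau_u+2\tau\kappa_{uu})+\kappa^3\tau_{uuu}+\kappa^2(5\kappa_u\tau_{uu}+6\tau_u\kappa_{uu}+2\tau\kappa_{uuu})\Big),$$ $$a_{34}=\frac1\kappa\Big(\big(\kappa\tau\sigma^2-4\kappa_u\tau_u-\kappa\tau_{uu}\big)\kappa-2\big(\kappa_u^2+\kappa\kappa_{uu}\big)\tau\Big).$$ Then the origin $p$ of the normal space $T_p^{\bot}S$ is classified as follows (all functions evaluated at $p$). (a) If $4a_{34}\kappa\tau\sigma^2+a_{23}^2>0$, then $p$ lies outside the curvature ellipse, so $p$ is a hyperbolic point of $S$. (b) If $4a_{34}\kappa\tau\sigma^2+a_{23}^2<0$, then $p$ lies inside the curvature ellipse, so $p$ is an elliptic point of $S$. (c) If $4a_{34}\kappa\tau\sigma^2+a_{23}^2=0$ and $\sigma\neq0$, then $p$ is non-degenerate. If $4a_{34}\kappa\tau\sigma^2+a_{23}^2=0$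 and $\sigma=0$, then: - if $a_{34}$ and $\kappa\tau$ have the same signs, $p$ is an inflection point of imaginary type; - if $a_{34}$ and $\kappa\tau$ have opposite signs, $p$ is non-degenerate; - if $a_{34}=0$, $p$ is an inflection point of flat type.
   Context: $E^4$ is Euclidean 4-space with inner product $\langle\cdot,\cdot\rangle$, and $x\times y\times z$ is the usual alternating ternary vector product of $E^4$ (with a fixed sign convention, e.g. $\langle w,x\times y\times z\rangle=\det(w,x,y,z)$). Subscripts $u,v$ denote partial derivatives. All functions are assumed sufficiently smooth on an open domain of the $(u,v)$-plane. ED$^2$-frame field: for each $v$, the unit speed curve $u\mapsto\Omega(u,v)$ lies on an oriented hypersurface of $E^4$; $T=\Omega_u$ and $N(u,v)$ is the unit normal of the hypersurface at $\Omega(u,v)$. One is in the case where $\{N,T,\Omega_{uu}\}$ is linearly dependent; $E$ is the normalization of $\Omega_{uuu}-\langle\Omega_{uuu},N\rangle N-\langle\Omega_{uuu},T\rangle T$ (assumed nonzero), and $D=N\times T\times E$. Associated functions: $\kappa=\kappa_n=\langle T_u,N\rangle$, $\sigma=\kappa_g^2=\langle E_u,D\rangle$ (the superscript in $\kappa_g^2$ is an index, not a power), $\tau=\tau_g^1=\langle E_u,N\rangle$. The frame satisfies $T_u=\kappa N$, $E_u=\sigma D+\tau N$, $D_u=-\sigma E$, $N_u=-\kappa T-\tau E$. Standing assumption: $\kappa$ and $\tau$ are nowhere zero. Curvature ellipse: at a point $p$ of $S$ it is the set $\{II(X,X): X\in T_pS,\ \|X\|=1\}$ in the normal plane $T_p^\bot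 S$, where $II$ is the (normal-valued) second fundamental form; it may degenerate to a segment or a point. The point $p$ is identified with the origin of $T_p^\bot S$. Let $\mathcal W=\kappa^2\tau$ and let $X_1=\Omega_u$, $X_2=\Omega_v/\mathcal W$ be the orthonormal tangent frame; put $h_{ij}^1=\langle II(X_i,X_j),E\rangle$, $h_{ij}^2=\langle II(X_i,X_j),N\rangle$. Define $$\Delta(p)=\frac14\det\begin{bmatrix} h_{11}^1 & 2h_{12}^1 & h_{22}^1 & 0 \\ h_{11}^2 & 2h_{12}^2 & h_{22}^2 & 0 \\ 0 & h_{11}^1 & 2h_{12}^1 & h_{22}^1 \\ 0 & h_{11}^2 & 2h_{12}^2 & h_{22}^2 \end{bmatrix}(p),\qquad A(p)=\begin{bmatrix} h_{11}^1 & h_{12}^1 & h_{22}^1 \\ h_{11}^2 & h_{12}^2 & h_{22}^2 \end{bmatrix}(p),$$ and let $K$ be the Gaussian curvature. Terminology: if $\Delta(p)<0$, $p$ lies outside the curvature ellipse and is called hyperbolic; if $\Delta(p)>0$, $p$ lies inside the curvature ellipse and is called elliptic; if $\Delta(p)=0$, $p$ lies on the curvature ellipse and is called parabolic, and in this case: if $K(p)>0$, $p$ is an inflection point of imaginary type; if $K(p)<0$ and $\operatorname{rank}A(p)=2$, the ellipse is non-degenerate (one says $p$ is non-degenerate); if $K(p)<0$ and $\operatorname{rank}A(p)=1$, $p$ is an inflection point of real type; if $K(p)=0$, $p$ is an inflection point of flat type.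
   Formalization: In (c) with σ=0 and a_34, κτ of opposite signs, ''p is non-degenerate'' is false (then a_23=0, so rank A=1); the formal theorem concludes instead that p is an inflection point of real type. *)

(* Defs.v *)
From HB Require Import structures.
From mathcomp Require Import all_boot all_order all_algebra.
From mathcomp Require Import all_classical all_reals all_analysis.

Set Implicit Arguments.
Unset Strict Implicit.
Unset Printing Implicit Defensive.

Import Order.TTheory GRing.Theory Num.Theory.
Import numFieldNormedType.Exports.

Local Open Scope classical_set_scope.
Local Open Scope ring_scope.

Section Calculus.
Context {R : realType}.

Definition pd (m : nat) (V : normedModType R) (i : 'I_m) (f : 'rV[R]_m -> V) :
  'rV[R]_m -> V := fun p => 'D_(delta_mx 0 i) f p.

(* On open U, asking for differentiability (not only for partial derivatives)
   at each stage does not change the class C^n, because the partial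
   derivatives of a C^(n+1) function are continuous. *)
Fixpoint Ck (m : nat) (V : normedModType R) (n : nat) (U : set 'rV[R]_m)
    (f : 'rV[R]_m -> V) : Prop :=
  if n is n'.+1 then
    (forall p, U p -> differentiable f p) /\ (forall i, Ck n' U (pd i f))
  else forall p, U p -> {for p, continuous f}.

Definition grad (m : nat) (F : 'rV[R]_m -> R) (x : 'rV[R]_m) : 'rV[R]_m :=
  \row_j pd j F x.

End Calculus.

Section Euclidean.
Context {R : realType}.

Definition dot (m : nat) (x y : 'rV[R]_m) : R := (x *m y^T) 0 0.

(* The library norm on matrices is the sup norm, hence this one. *)
Definition enorm (m : nat) (x : 'rV[R]_m) : R := Num.sqrt (dot x x).

Definition rows_mx (m n : nat) (s : seq 'rV[R]_n) : 'M[R]_(m, n) :=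
  \matrix_(i < m) nth 0 s i.

Definition entries_mx (m n : nat) (s : seq (seq R)) : 'M[R]_(m, n) :=
  \matrix_(i < m, j < n) nth 0 (nth [::] s i) j.

(* The sign is fixed by <w, x * y * z> = det (w, x, y, z) for every w. *)
Definition cross (x y z : 'rV[R]_4) : 'rV[R]_4 :=
  \row_i \det (rows_mx 4 [:: delta_mx 0 i; x; y; z]).

Definition convex_hull (A : set 'rV[R]_4) : set 'rV[R]_4 :=
  smallest (@convex_set R 'rV[R]_4) A.

(* M is locally a regular level set, and nu is the unit normal chosen by the
   orientation. *)
Definition oriented_hypersurface (M : set 'rV[R]_4)
    (nu : 'rV[R]_4 -> 'rV[R]_4) : Prop :=
  forall q, M q -> exists (O : set 'rV[R]_4) (F : 'rV[R]_4 -> R),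
    [/\ open O, O q, Ck 1 O F,
        M `&` O = [set x | F x = 0] `&` O &
        forall x, (M `&` O) x ->
          grad F x != 0 /\ nu x = (enorm (grad F x))^-1 *: grad F x].

End Euclidean.

(* A point p : 'rV_2 of the parameter plane has coordinates u = p 0 0 and
   v = p 0 1, so that pd 0 and pd 1 are the subscripts u and v. *)
Section Surface.
Context {R : realType}.
Implicit Types (Om : 'rV[R]_2 -> 'rV[R]_4) (p : 'rV[R]_2).

Definition betchov_da_rios (U : set 'rV[R]_2) Om : Prop :=
  forall p, U p ->
    pd 1 Om p =
      cross (pd 0 Om p) (pd 0 (pd 0 Om) p) (pd 0 (pd 0 (pd 0 Om)) p).

Definition tangent_mx Om p : 'M[R]_(2, 4) := \matrix_(i < 2) pd i Om p.

(* Coordinates, in the basis (Om_u, Om_v), of the orthogonal projection of X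
   on the tangent plane. *)
Definition tangent_coord Om p (X : 'rV[R]_4) : 'rV[R]_2 :=
  let A := tangent_mx Om p in X *m A^T *m invmx (A *m A^T).

Definition normal_part Om p (X : 'rV[R]_4) : 'rV[R]_4 :=
  X - tangent_coord Om p X *m tangent_mx Om p.

Definition second_fundamental_form Om p (X Y : 'rV[R]_4) : 'rV[R]_4 :=
  let x := tangent_coord Om p X in
  let y := tangent_coord Om p Y in
  normal_part Om p (\sum_i \sum_j (x 0 i * y 0 j) *: pd i (pd j Om) p).

Definition curvature_ellipse Om p : set 'rV[R]_4 :=
  [set second_fundamental_form Om p X X | X in
     [set X : 'rV[R]_4 | (X <= tangent_mx Om p)%MS /\ enorm X = 1]].

(* The ellipse bounds its convex hull within the normal plane; for a segment
   or a point the hull is the ellipse itself, and nothing lies inside. *)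
Definition outside_curvature_ellipse Om p : Prop :=
  ~ convex_hull (curvature_ellipse Om p) 0.

Definition inside_curvature_ellipse Om p : Prop :=
  convex_hull (curvature_ellipse Om p) 0 /\ ~ curvature_ellipse Om p 0.

Definition metric Om p : 'M[R]_2 :=
  \matrix_(i, j) dot (pd i Om p) (pd j Om p).

Definition christoffel Om (k i j : 'I_2) p : R :=
  2^-1 * \sum_l invmx (metric Om p) k l *
    (pd i (fun q => metric Om q j l) p + pd j (fun q => metric Om q i l) p
     - pd l (fun q => metric Om q i j) p).

(* R(d_i, d_j) d_k = \sum_l riemann l k i j d_l. *)
Definition riemann Om (l k i j : 'I_2) p : R :=
  pd i (christoffel Om l j k) p - pd j (christoffel Om l i k) p
  + \sum_m (christoffel Om l i m p * christoffel Om m j k p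
            - christoffel Om l j m p * christoffel Om m i k p).

(* <R(d_u, d_v) d_v, d_u> / det g, which is positive on round spheres. *)
Definition gauss_curvature Om p : R :=
  (\sum_l metric Om p 0 l * riemann Om l 1 0 1 p) / \det (metric Om p).

End Surface.

Section Frame.
Context {R : realType}.
Implicit Types (Om T E D N : 'rV[R]_2 -> 'rV[R]_4) (p : 'rV[R]_2).

Definition ED_residual Om T N p : 'rV[R]_4 :=
  let Ouuu := pd 0 (pd 0 (pd 0 Om)) p in
  Ouuu - dot Ouuu (N p) *: N p - dot Ouuu (T p) *: T p.

Record ED2_frame (U : set 'rV[R]_2) Om T E D N : Prop := {
  (* the hypersurface may change with v *)
  ED2_hypersurface : forall v : R,
    exists (M : set 'rV[R]_4) (nu : 'rV[R]_4 -> 'rV[R]_4),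
      oriented_hypersurface M nu /\
      forall p, U p -> p 0 1 = v -> M (Om p) /\ N p = nu (Om p);
  ED2_T : forall p, U p -> T p = pd 0 Om p;
  ED2_dependent : forall p, U p ->
    ~~ row_free (rows_mx 3 [:: N p; T p; pd 0 (pd 0 Om) p]);
  ED2_residual_neq0 : forall p, U p -> ED_residual Om T N p != 0;
  ED2_E : forall p, U p ->
    E p = (enorm (ED_residual Om T N p))^-1 *: ED_residual Om T N p;
  ED2_D : forall p, U p -> D p = cross (N p) (T p) (E p)
}.

Definition kappa T N p : R := dot (pd 0 T p) (N p).
Definition sigma E D p : R := dot (pd 0 E p) (D p).
Definition tau E N p : R := dot (pd 0 E p) (N p).

End Frame.

Section Classification.
Context {R : realType}.
Variables (Om T E N : 'rV[R]_2 -> 'rV[R]_4).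
Implicit Types p : 'rV[R]_2.

Definition Wfun p : R := kappa T N p ^+ 2 * tau E N p.

Definition X1 p : 'rV[R]_4 := pd 0 Om p.
Definition X2 p : 'rV[R]_4 := (Wfun p)^-1 *: pd 1 Om p.

Definition h11_1 p : R := dot (second_fundamental_form Om p (X1 p) (X1 p)) (E p).
Definition h12_1 p : R := dot (second_fundamental_form Om p (X1 p) (X2 p)) (E p).
Definition h22_1 p : R := dot (second_fundamental_form Om p (X2 p) (X2 p)) (E p).
Definition h11_2 p : R := dot (second_fundamental_form Om p (X1 p) (X1 p)) (N p).
Definition h12_2 p : R := dot (second_fundamental_form Om p (X1 p) (X2 p)) (N p).
Definition h22_2 p : R := dot (second_fundamental_form Om p (X2 p) (X2 p)) (N p).

Definition Delta p : R :=
  4^-1 * \det (entries_mx 4 4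
    [:: [:: h11_1 p; 2 * h12_1 p; h22_1 p;     0      ];
        [:: h11_2 p; 2 * h12_2 p; h22_2 p;     0      ];
        [:: 0;       h11_1 p;     2 * h12_1 p; h22_1 p];
        [:: 0;       h11_2 p;     2 * h12_2 p; h22_2 p]]).

Definition Amx p : 'M[R]_(2, 3) :=
  entries_mx 2 3 [:: [:: h11_1 p; h12_1 p; h22_1 p];
                     [:: h11_2 p; h12_2 p; h22_2 p]].

Definition hyperbolic p : Prop := Delta p < 0.
Definition elliptic p : Prop := 0 < Delta p.
Definition parabolic p : Prop := Delta p = 0.

Definition non_degenerate p : Prop :=
  [/\ parabolic p, gauss_curvature Om p < 0 & \rank (Amx p) = 2].

Definition inflection_imaginary p : Prop :=
  parabolic p /\ 0 < gauss_curvature Om p.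

(* For a solution with ED^2-frame, h11_1 = 0, h12_1 = - sigma and
   h22_1 = - a23 / Wfun. Where sigma = a23 = 0 the first row of Amx therefore
   vanishes: the rank is 1, the ellipse is a segment, and a parabolic point
   with negative curvature is of this type, never non_degenerate. *)
Definition inflection_real p : Prop :=
  [/\ parabolic p, gauss_curvature Om p < 0 & \rank (Amx p) = 1].

Definition inflection_flat p : Prop :=
  parabolic p /\ gauss_curvature Om p = 0.

End Classification.

Section Coefficients.
Context {R : realType}.
Variables (k s t : 'rV[R]_2 -> R). (* kappa, sigma, tau *)
Implicit Types p : 'rV[R]_2.

Definition a23 p : R :=
  let ku := pd 0 k p in let kuu := pd 0 (pd 0 k) p in
  let kuuu := pd 0 (pd 0 (pd 0 k)) p in
  let tu := pd 0 t p in let tuu := pd 0 (pd 0 t) p in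
  let tuuu := pd 0 (pd 0 (pd 0 t)) p in
  let su := pd 0 s p in
  let k := k p in let s := s p in let t := t p in
  -1 / (t * k ^+ 2) *
  (- 3 * k ^+ 3 * t * s * su + k ^+ 5 * tu + 2 * k ^+ 4 * t * ku
   - 2 * t * ku ^+ 3 - k ^+ 2 * s ^+ 2 * (3 * k * tu + 5 * t * ku)
   + 2 * k * ku * (ku * tu + 2 * t * kuu) + k ^+ 3 * tuuu
   + k ^+ 2 * (5 * ku * tuu + 6 * tu * kuu + 2 * t * kuuu)).

Definition a34 p : R :=
  let ku := pd 0 k p in let kuu := pd 0 (pd 0 k) p in
  let tu := pd 0 t p in let tuu := pd 0 (pd 0 t) p in
  let k := k p in let s := s p in let t := t p in
  1 / k * ((k * t * s ^+ 2 - 4 * ku * tu - k * tuu) * k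
           - 2 * (ku ^+ 2 + k * kuu) * t).

End Coefficients.

(* Main.v *)
Require Import Defs.
From HB Require Import structures.
From mathcomp Require Import all_boot all_order all_algebra.
From mathcomp Require Import all_classical all_reals all_analysis.
From mathcomp Require Import ring lra.

(**
The Betchov-Da Rios equation reads Om_v = W D with W = kappa^2 tau, so the
first fundamental form is du^2 + W^2 dv^2 and K = - W_uu / W.  Equality of the
mixed u, v derivatives of Om, T and N determines the v-derivatives of the frame
from the u-derivatives of kappa, sigma and tau, and identifies
a23 = <E_v, D> and a34 = - <N_v, D>.  In the orthonormal tangent frame (T, D)
the second fundamental form, with values in the plane spanned by E and N, is
  II(x T + y D) = (- 2 x y sigma - y^2 a23 / W) E + (x^2 kappa + y^2 a34 / W) N,
and everything else is the discussion of this pencil of two quadratic forms in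
(x, y): its Delta is - kappa^2 / (4 W^2) times the discriminant of the theorem
and K = a34 / (kappa tau) - sigma^2.  When the discriminant is positive some
combination of the two forms is positive definite, which separates the origin
from the ellipse; when it is negative the first form vanishes in two directions
on which the second one takes opposite signs.
*)

Set Implicit Arguments.
Unset Strict Implicit.
Unset Printing Implicit Defensive.

Import Order.TTheory GRing.Theory Num.Theory.
Import numFieldNormedType.Exports.

Local Open Scope classical_set_scope.
Local Open Scope ring_scope.

(** * Symmetry of mixed derivatives *)

Section Line.
Context {R : realType} {V : normedModType R}.
Implicit Types (f : V -> R) (a b c p : V) (x h : R).

(** The difference quotients of [f] in the direction [a] are those of a function of one real
    variable, which brings the one-variable mean value theorem to segments. *)
Lemma is_derive_line f a c x : derivable f (x *: a + c) a ->
  is_derive x 1 (fun y : R => f (y *: a + c)) ('D_a f (x *: a + c)).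
Proof.
move=> df.
have E : (fun h => h^-1 *: (f ((h *: (1 : R) + x) *: a + c) - f (x *: a + c))) =
         (fun h => h^-1 *: (f (h *: a + (x *: a + c)) - f (x *: a + c))) :> (R -> R).
  by apply/funext => h; rewrite scalerDl /= [h *: 1]mulr1 addrA.
by apply: DeriveDef; rewrite ?/derivable ?/derive E.
Qed.

Lemma MVT_line f a c h : 0 < h ->
  (forall x, 0 <= x <= h -> derivable f (x *: a + c) a) ->
  exists2 x, 0 <= x <= h & f (h *: a + c) - f c = 'D_a f (x *: a + c) * h.
Proof.
move=> h0 df.
have [||x] := @MVT R (fun y => f (y *: a + c)) (fun y => 'D_a f (y *: a + c)) 0 h h0.
- by move=> x; rewrite in_itv/= => /andP[x0 xh]; apply/is_derive_line/df; rewrite !ltW.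
- apply: derivable_within_continuous => x; rewrite in_itv/= => xh.
  by have [] := is_derive_line (df x xh).
rewrite in_itv/= => /andP[x0 xh]; rewrite scale0r add0r subr0 => E.
by exists x => //; rewrite !ltW.
Qed.

Definition second_difference f a b p h : R :=
  f (h *: a + (h *: b + p)) - f (h *: a + p) - (f (h *: b + p) - f p).

(* The mean value theorem, first in the direction [a], then in the direction [b]. *)
Lemma second_difference_near f a b p (U : set V) : open U -> U p ->
  (forall q, U q -> derivable f q a) ->
  (forall q, U q -> derivable ('D_a f) q b) ->
  {for p, continuous ('D_b ('D_a f))} ->
  forall e, 0 < e -> \forall h \near 0^'+,
    `|second_difference f a b p h - 'D_b ('D_a f) p * h ^+ 2| <= e * h ^+ 2.
Proof.
move=> oU Up dfa dfab cf e e0.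
have : \forall q \near p, U q /\ `|'D_b ('D_a f) p - 'D_b ('D_a f) q| < e.
  apply: filterI; first exact: open_nbhs_nbhs.
  by move/cvgrPdist_lt : cf; exact.
move=> /nbhs_ballP[r /= r0 rP].
(* For [x] and [y] in [[0, h]] the displacement [x *: a + y *: b] has norm at most [h * M]; the
   summand 1 keeps [M] positive even if both directions vanish. *)
pose M := `|a| + `|b| + 1.
have M0 : 0 < M by rewrite ltr_wpDl// addr_ge0.
near=> h.
have h0 : 0 < h by [].
have hM : h * M < r by rewrite -ltr_pdivlMr//; near: h; apply: nbhs_right_lt; rewrite divr_gt0.
have inU x y : 0 <= x <= h -> 0 <= y <= h ->
    U (x *: a + (y *: b + p)) /\
    `|'D_b ('D_a f) p - 'D_b ('D_a f) (x *: a + (y *: b + p))| < e.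
  move=> /andP[x0 xh] /andP[y0 yh]; apply: rP; rewrite -ball_normE /ball_/=.
  rewrite addrA opprD addrCA subrr addr0 normrN (le_lt_trans _ hM)//.
  rewrite (le_trans (ler_normD _ _))// !normrZ !ger0_norm// /M.
  have := ler_wpM2r (normr_ge0 a) xh; have := ler_wpM2r (normr_ge0 b) yh; lra.
have z0 : 0 <= (0 : R) <= h by rewrite lexx ltW.
have hh : 0 <= h <= h by rewrite lexx ltW.
(* The second difference is the increment of [g] from [p] to [h *: a + p], and the derivative of [g]
   along [a] is an increment of ['D_a f] along [b]. *)
pose g q := f (h *: b + q) - f q.
have der_g q : U q -> U (h *: b + q) -> is_derive q a g ('D_a f (h *: b + q) - 'D_a f q).
  move=> Uq Uhq; apply: is_deriveB; last by apply: derivableP; exact: dfa.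
  have E : (fun k => k^-1 *: (f (h *: b + (k *: a + q)) - f (h *: b + q))) =
           (fun k => k^-1 *: (f (k *: a + (h *: b + q)) - f (h *: b + q))) :> (R -> R).
    by apply/funext => k; rewrite addrCA.
  have := dfa _ Uhq.
  by move=> ?; apply: DeriveDef; rewrite ?/derivable ?/derive E.
have Ug x : 0 <= x <= h -> U (x *: a + p) /\ U (h *: b + (x *: a + p)).
  move=> xh; split; first by have [] := inU _ _ xh z0; rewrite scale0r add0r.
  by rewrite addrCA; have [] := inU _ _ xh hh.
have [x xh Ex] : exists2 x, 0 <= x <= h & g (h *: a + p) - g p = 'D_a g (x *: a + p) * h.
  apply: (@MVT_line g a p h h0) => x /Ug[U1 U2].
  by have [] := der_g _ U1 U2.
have [y yh Ey] : exists2 y, 0 <= y <= h &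
    'D_a f (h *: b + (x *: a + p)) - 'D_a f (x *: a + p) =
    'D_b ('D_a f) (y *: b + (x *: a + p)) * h.
  apply: (@MVT_line ('D_a f) b (x *: a + p) h h0) => y yh; apply: dfab; rewrite addrCA.
  by have [] := inU _ _ xh yh.
have [U1 U2] := Ug _ xh.
have [_ dg] := der_g _ U1 U2.
have -> : second_difference f a b p h = 'D_b ('D_a f) (y *: b + (x *: a + p)) * h * h.
  by rewrite -Ey -dg -Ex /second_difference /g [h *: b + (_ + _)]addrCA.
have [_] := inU _ _ xh yh; rewrite addrCA distrC => /ltW lte.
rewrite -mulrA -expr2 -mulrBl normrM (ger0_norm (sqr_ge0 h)).
by rewrite ler_wpM2r// sqr_ge0.
Unshelve. all: by end_near. Qed.

(** The second difference is symmetric in [a] and [b], and divided by [h ^+ 2] it approximates both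
    iterated derivatives. With an error of a third of their gap on each side, a nonzero gap would be
    at most two thirds of itself. *)
Lemma derive_comm f a b p (U : set V) : open U -> U p ->
  (forall q, U q -> derivable f q a) -> (forall q, U q -> derivable f q b) ->
  (forall q, U q -> derivable ('D_a f) q b) ->
  (forall q, U q -> derivable ('D_b f) q a) ->
  {for p, continuous ('D_b ('D_a f))} -> {for p, continuous ('D_a ('D_b f))} ->
  'D_b ('D_a f) p = 'D_a ('D_b f) p.
Proof.
move=> oU Up fa fb fab fba cab cba.
have third (z : R) : 0 < z -> ~~ (z <= z / 3 + z / 3) by lra.
apply/eqP/negP => /negP ne.
pose e := `|'D_b ('D_a f) p - 'D_a ('D_b f) p| / 3.
have e0 : 0 < e by rewrite divr_gt0// normr_gt0 subr_eq0.
have Hab := second_difference_near oU Up fa fab cab e0.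
have Hba := second_difference_near oU Up fb fba cba e0.
have dn0 : 0 < `|'D_b ('D_a f) p - 'D_a ('D_b f) p| by rewrite normr_gt0 subr_eq0.
move: Hab Hba e0 dn0; rewrite {}/e.
move: ('D_b ('D_a f) p) ('D_a ('D_b f) p) => X Y Hab Hba e0 dn0.
have : \forall h \near (0 : R)^'+, False.
  near=> h.
  have h0 : 0 < h by [].
  have h2 : 0 < h ^+ 2 by rewrite exprn_gt0.
  have h_ab : `|second_difference f a b p h - X * h ^+ 2| <= `|X - Y| / 3 * h ^+ 2.
    by near: h; exact: Hab.
  have : `|second_difference f b a p h - Y * h ^+ 2| <= `|X - Y| / 3 * h ^+ 2.
    by near: h; exact: Hba.
  have <- : second_difference f a b p h = second_difference f b a p h.
    rewrite /second_difference [h *: a + (_ + _)]addrCA !opprB.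
    by move: (f _) (f _) (f _) (f _) => u v w z; ring.
  move: (second_difference _ _ _ _ _) h_ab => S h_ab h_ba.
  have : `|X - Y| * h ^+ 2 <= `|X - Y| / 3 * h ^+ 2 + `|X - Y| / 3 * h ^+ 2.
    rewrite -[X in _ * X <= _](ger0_norm (ltW h2)) -normrM.
    rewrite (_ : (X - Y) * h ^+ 2 = (S - Y * h ^+ 2) - (S - X * h ^+ 2)); last by ring.
    by rewrite (le_trans (ler_normB _ _))// lerD.
  by rewrite -mulrDl ler_pM2r// (negPf (third _ dn0)).
by move=> /filter_ex[].
Unshelve. all: by end_near. Qed.

End Line.

(** * Functions of class C^n *)

Section Ck_theory.
Context {R : realType} {m : nat}.
Variable U : set 'rV[R]_m.
Hypothesis oU : open U.
Implicit Types (i : 'I_m) (p : 'rV[R]_m).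

Lemma eq_pd (V : normedModType R) i (f g : 'rV[R]_m -> V) :
  (forall p, U p -> f p = g p) -> forall p, U p -> pd i f p = pd i g p.
Proof.
move=> fg p Up; apply: near_eq_derive.
by apply: filterS (open_nbhs_nbhs (conj oU Up)) => q; exact: fg.
Qed.

(** The difference [z] of the two functions vanishes near [p], so the little-o criterion gives it
    the zero differential there; [g] is [f + z]. *)
Lemma eq_differentiable (V : normedModType R) (f g : 'rV[R]_m -> V) :
  (forall p, U p -> f p = g p) ->
  forall p, U p -> differentiable f p -> differentiable g p.
Proof.
move=> fg p Up df; pose z := g - f.
have z0 q : U q -> z q = 0 by move=> Uq; rewrite /z !fctE fg ?subrr.
suff dz : differentiable z p.
  have -> : g = f + z by rewrite /z addrC subrK.
  exact: differentiableD.
have E : z \o shift p = cst (z p) + \0 +o_ (0 : 'rV[R]_m) id.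
  apply/eqaddoP => e e0.
  have : \forall h \near (0 : 'rV[R]_m), U (h + p).
    rewrite (near_shift p)/=; near=> q; rewrite /= sub0r addrNK; near: q.
    exact: open_nbhs_nbhs.
  apply: filterS => h Uh; rewrite !fctE/= z0// z0// addr0 subr0 normr0.
  by rewrite mulr_ge0// ltW.
have D : 'd z p = \0 :> (_ -> _).
  apply: diff_unique => //; exact: cst_continuous.
by apply/diff_locallyP; rewrite D; split => //; exact: cst_continuous.
Unshelve. all: by end_near. Qed.

(** Formulas for partial derivatives hold only at points of [U], while [Ck] recurses on functions
    defined everywhere; this congruence bridges the two. *)
Lemma eq_Ck (V : normedModType R) n (f g : 'rV[R]_m -> V) :
  (forall p, U p -> f p = g p) -> Ck n U f -> Ck n U g.
Proof.
elim: n f g => [|n IHn] f g fg /=.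
  move=> cf p Up; suff : g @ p --> f p by rewrite fg.
  have /near_eq_cvg : \forall q \near p, f q = g q.
    by apply: filterS (open_nbhs_nbhs (conj oU Up)) => q; exact: fg.
  by move/cvg_trans; apply; exact: cf.
move=> [df Cf]; split => [p Up|i].
  exact: (eq_differentiable fg Up (df p Up)).
by apply: IHn (Cf i); exact: eq_pd.
Qed.

Lemma CkS (V : normedModType R) n (f : 'rV[R]_m -> V) : Ck n.+1 U f -> Ck n U f.
Proof.
elim: n f => [|n IHn] f [df Cf]; first by move=> p Up; exact/differentiable_continuous/df.
by split => // i; exact/IHn/Cf.
Qed.

Lemma Ck_le (V : normedModType R) k n (f : 'rV[R]_m -> V) : (k <= n)%N ->
  Ck n U f -> Ck k U f.
Proof.
by move=> /subnK <-; elim: (n - k)%N => [//|j IHj]; rewrite addSn => /CkS.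
Qed.

Lemma pdD (V : normedModType R) i (f g : 'rV[R]_m -> V) p :
  differentiable f p -> differentiable g p ->
  pd i (f + g) p = pd i f p + pd i g p.
Proof. by move=> df dg; rewrite /pd deriveD//; exact: diff_derivable. Qed.

Lemma pdM i (f g : 'rV[R]_m -> R) p :
  differentiable f p -> differentiable g p ->
  pd i (fun q => f q * g q) p = f p * pd i g p + g p * pd i f p.
Proof. by move=> df dg; apply: deriveM; exact: diff_derivable. Qed.

Lemma CkD (V : normedModType R) n (f g : 'rV[R]_m -> V) :
  Ck n U f -> Ck n U g -> Ck n U (f + g).
Proof.
elim: n f g => [|n IHn] f g.
  by move=> cf cg p Up; apply: continuousD; [exact: cf|exact: cg].
move=> [df Cf] [dg Cg]; split => [p Up|i].
  by apply: differentiableD; [exact: df|exact: dg].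
apply: eq_Ck (IHn _ _ (Cf i) (Cg i)) => p Up.
by rewrite pdD//; [exact: df|exact: dg].
Qed.

Lemma CkM n (f g : 'rV[R]_m -> R) :
  Ck n U f -> Ck n U g -> Ck n U (fun q => f q * g q).
Proof.
elim: n f g => [|n IHn] f g Cf Cg.
  by move=> p Up; apply: continuousM; [exact: Cf|exact: Cg].
(* The Leibniz rule keeps undifferentiated factors, so both functions are also needed at order
   [n]. *)
have [Cf' Cg'] := (CkS Cf, CkS Cg).
case: Cf Cg => [df Cf] [dg Cg]; split => [p Up|i].
  by apply: differentiableM; [exact: df|exact: dg].
apply: eq_Ck (CkD (IHn _ _ Cf' (Cg i)) (IHn _ _ Cg' (Cf i))) => p Up.
by rewrite pdM//; [exact: df|exact: dg].
Qed.

Lemma Ck_cst (V : normedModType R) n (c : V) : Ck n U (fun=> c).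
Proof.
elim: n c => [|n IHn] c; first by move=> p _; exact: cst_continuous.
split => [p _|i]; first exact: differentiable_cst.
by apply: eq_Ck (IHn 0) => p _; rewrite /pd derive_cst.
Qed.

Lemma Ck_sum (V : normedModType R) n k (f : 'I_k -> 'rV[R]_m -> V) :
  (forall j, Ck n U (f j)) -> Ck n U (\sum_j f j).
Proof.
move=> Cf; elim/big_ind: _ => //; [exact: Ck_cst | exact: CkD].
Qed.

(** * Vector-valued functions, coordinate by coordinate *)

Section coordinates.
Context {k : nat}.
Implicit Types f g : 'rV[R]_m -> 'rV[R]_k.

Lemma pd_coord i f j p : differentiable f p ->
  pd i f p 0 j = pd i (fun q => f q 0 j) p.
Proof.
by move=> df; rewrite /pd derive_mx ?mxE//; exact: diff_derivable.
Qed.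

Lemma differentiable_mx_coord f j p : differentiable f p ->
  differentiable (fun q => f q 0 j) p.
Proof.
by move=> df; apply: (@differentiable_comp _ _ _ _ f (fun N => N 0 j)) => //; exact: differentiable_coord.
Qed.

Lemma Ck_coord n f j : Ck n U f -> Ck n U (fun q => f q 0 j).
Proof.
elim: n f => [|n IHn] f.
  move=> cf p Up; apply: (@continuous_comp _ _ _ f (fun N => N 0 j)); first exact: cf.
  exact: coord_continuous.
move=> [df Cf]; split => [p Up|i]; first exact/differentiable_mx_coord/df.
by apply: eq_Ck (IHn _ (Cf i)) => p Up; rewrite pd_coord//; exact: df.
Qed.

Lemma dotE (x y : 'rV[R]_k) : dot x y = \sum_j x 0 j * y 0 j.
Proof. by rewrite /dot mxE; apply: eq_bigr => j _; rewrite mxE. Qed.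

Lemma dot_funE f g : (fun q => dot (f q) (g q)) =
  \sum_j (fun q => f q 0 j * g q 0 j).
Proof. by apply/funext => q; rewrite dotE fct_sumE. Qed.

Lemma Ck_dot n f g : Ck n U f -> Ck n U g -> Ck n U (fun q => dot (f q) (g q)).
Proof.
by move=> Cf Cg; rewrite dot_funE; apply: Ck_sum => j; apply: CkM; exact: Ck_coord.
Qed.

Lemma pd_dot i f g p : differentiable f p -> differentiable g p ->
  pd i (fun q => dot (f q) (g q)) p = dot (pd i f p) (g p) + dot (f p) (pd i g p).
Proof.
move=> df dg; rewrite dot_funE /pd derive_sum => [|j]; last first.
  by apply: derivableM; apply/diff_derivable/differentiable_mx_coord.
rewrite !dotE -big_split/=; apply: eq_bigr => j _.
have E := pdM i (differentiable_mx_coord j df) (differentiable_mx_coord j dg).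
apply: (etrans E); rewrite -(pd_coord i j df) -(pd_coord i j dg).
by rewrite addrC; congr (_ + _); exact: mulrC.
Qed.

Lemma pdZ i (a : 'rV[R]_m -> R) f p : differentiable a p -> differentiable f p ->
  pd i (fun q => a q *: f q) p = pd i a p *: f p + a p *: pd i f p.
Proof.
move=> da df; apply/rowP => j.
rewrite {1}/pd derive_mx; last first.
  apply/derivable_mxP => i' j'; rewrite (ord1 i').
  rewrite (_ : (fun x => _) = (fun x => a x * f x 0 j')); last by apply/funext => q; rewrite mxE.
  by apply: derivableM; apply: diff_derivable => //; exact: differentiable_mx_coord.
rewrite mxE (_ : (fun x => _) = (fun x => a x * f x 0 j)); last by apply/funext => q; rewrite mxE.
rewrite -/(pd i _ p) pdM//; last exact: differentiable_mx_coord.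
by rewrite -pd_coord// !mxE addrC; congr (_ + _); exact: mulrC.
Qed.

Lemma pd_comm_real i j (f : 'rV[R]_m -> R) p : Ck 2 U f -> U p ->
  pd i (pd j f) p = pd j (pd i f) p.
Proof.
move=> [df Cf] Up; apply: (derive_comm oU Up).
- by move=> q Uq; exact/diff_derivable/df.
- by move=> q Uq; exact/diff_derivable/df.
- by move=> q Uq; have [d _] := Cf j; exact/diff_derivable/d.
- by move=> q Uq; have [d _] := Cf i; exact/diff_derivable/d.
- by have [_ c] := Cf j; exact: c.
- by have [_ c] := Cf i; exact: c.
Qed.

Lemma pd_comm i j f p : Ck 2 U f -> U p -> pd i (pd j f) p = pd j (pd i f) p.
Proof.
move=> Cf Up; apply/rowP => l; have [df Cf1] := Cf.
have E i' j' : pd i' (pd j' f) p 0 l = pd i' (pd j' (fun q => f q 0 l)) p.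
  rewrite pd_coord; last by have [d _] := Cf1 j'; exact: d.
  by apply: eq_pd => // q Uq; rewrite pd_coord//; exact: df.
apply: (etrans (E i j)); apply: (etrans _ (esym (E j i))).
exact: pd_comm_real (Ck_coord _ Cf) Up.
Qed.

End coordinates.
End Ck_theory.

(** * The ternary vector product *)

Section Determinant.
Context {R : comNzRingType}.

(** Entries given by a function on [nat] keep their shape in minors, up to reindexing by [bump], so
    each size of determinant expands into the previous one. *)
Lemma det_nat2 (F : nat -> nat -> R) :
  \det (\matrix_(i < 2, j < 2) F i j) = F 0 0 * F 1 1 - F 0 1 * F 1 0.
Proof.
rewrite (expand_det_row _ ord0) !big_ord_recl big_ord0 /cofactor.
by rewrite !det_mx11 !mxE /=; ring.
Qed.

Lemma det_nat3 (F : nat -> nat -> R) :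
  \det (\matrix_(i < 3, j < 3) F i j) =
    F 0 0 * (F 1 1 * F 2 2 - F 1 2 * F 2 1)
  - F 0 1 * (F 1 0 * F 2 2 - F 1 2 * F 2 0)
  + F 0 2 * (F 1 0 * F 2 1 - F 1 1 * F 2 0).
Proof.
rewrite (expand_det_row _ ord0) !big_ord_recl big_ord0 /cofactor.
pose G (k i j : nat) := F (bump 0 i) (bump k j).
have E (k : 'I_3) :
    row' ord0 (col' k (\matrix_(i < 3, j < 3) F i j)) = \matrix_(i < 2, j < 2) G k i j.
  by apply/matrixP => i j; rewrite !mxE.
by rewrite !E !det_nat2 !mxE /G /=; ring.
Qed.

Lemma det_nat4 (F : nat -> nat -> R) :
  \det (\matrix_(i < 4, j < 4) F i j) =
    F 0 0 * (F 1 1 * (F 2 2 * F 3 3 - F 2 3 * F 3 2)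
           - F 1 2 * (F 2 1 * F 3 3 - F 2 3 * F 3 1)
           + F 1 3 * (F 2 1 * F 3 2 - F 2 2 * F 3 1))
  - F 0 1 * (F 1 0 * (F 2 2 * F 3 3 - F 2 3 * F 3 2)
           - F 1 2 * (F 2 0 * F 3 3 - F 2 3 * F 3 0)
           + F 1 3 * (F 2 0 * F 3 2 - F 2 2 * F 3 0))
  + F 0 2 * (F 1 0 * (F 2 1 * F 3 3 - F 2 3 * F 3 1)
           - F 1 1 * (F 2 0 * F 3 3 - F 2 3 * F 3 0)
           + F 1 3 * (F 2 0 * F 3 1 - F 2 1 * F 3 0))
  - F 0 3 * (F 1 0 * (F 2 1 * F 3 2 - F 2 2 * F 3 1)
           - F 1 1 * (F 2 0 * F 3 2 - F 2 2 * F 3 0)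
           + F 1 2 * (F 2 0 * F 3 1 - F 2 1 * F 3 0)).
Proof.
rewrite (expand_det_row _ ord0) !big_ord_recl big_ord0 /cofactor.
pose G (k i j : nat) := F (bump 0 i) (bump k j).
have E (k : 'I_4) :
    row' ord0 (col' k (\matrix_(i < 4, j < 4) F i j)) = \matrix_(i < 3, j < 3) G k i j.
  by apply/matrixP => i j; rewrite !mxE.
by rewrite !E !det_nat3 !mxE /G /=; ring.
Qed.

End Determinant.

Section Space.
Context {R : realType}.
Implicit Types (x y z w : 'rV[R]_4) (a b : R).

(** Natural indices let the explicit determinant expansions be stated with numerals. Only [n < 4] is
    meaningful: [inord] sends the other values to the index 0. *)
Definition nat_coord x (n : nat) : R := x 0 (inord n).

Lemma nat_coordE x (i : 'I_4) : x 0 i = nat_coord x i.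
Proof. by rewrite /nat_coord inord_val. Qed.

Lemma dot4E x y : dot x y =
  nat_coord x 0 * nat_coord y 0 + nat_coord x 1 * nat_coord y 1 +
  nat_coord x 2 * nat_coord y 2 + nat_coord x 3 * nat_coord y 3.
Proof.
rewrite dotE; under eq_bigr do rewrite !nat_coordE.
by rewrite !big_ord_recl big_ord0 /= addr0 !addrA.
Qed.

Definition minor3 x y z (i j k : nat) : R :=
  let: (x, y, z) := (nat_coord x, nat_coord y, nat_coord z) in
  x i * (y j * z k - y k * z j) - x j * (y i * z k - y k * z i)
  + x k * (y i * z j - y j * z i).

Lemma det_rows4E w x y z : \det (rows_mx 4 [:: w; x; y; z]) =
  nat_coord w 0 * minor3 x y z 1 2 3 - nat_coord w 1 * minor3 x y z 0 2 3
  + nat_coord w 2 * minor3 x y z 0 1 3 - nat_coord w 3 * minor3 x y z 0 1 2.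
Proof.
pose F i j := nat_coord (nth 0 [:: w; x; y; z] i) j.
rewrite (_ : rows_mx _ _ = \matrix_(i < 4, j < 4) F i j); first by rewrite det_nat4.
by apply/matrixP => i j; rewrite !mxE nat_coordE.
Qed.

Lemma nat_coord_delta (i : 'I_4) n : (n < 4)%N ->
  nat_coord (delta_mx 0 i) n = (n == i)%:R :> R.
Proof. by move=> n4; rewrite /nat_coord mxE eqxx/= -val_eqE/= inordK. Qed.

Lemma cross_coord x y z : forall n, (n < 4)%N -> nat_coord (cross x y z) n =
  nth 0 [:: minor3 x y z 1 2 3; - minor3 x y z 0 2 3;
            minor3 x y z 0 1 3; - minor3 x y z 0 1 2] n.
Proof.
move=> n n4; rewrite {1}/nat_coord mxE det_rows4E !nat_coord_delta//= inordK//.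
by case: n n4 => [|[|[|[|n]]]]//= _; rewrite ?mul1r ?mul0r ?subr0 ?addr0 ?add0r ?sub0r.
Qed.

Lemma dot_cross w x y z : dot w (cross x y z) = \det (rows_mx 4 [:: w; x; y; z]).
Proof. by rewrite dot4E det_rows4E !cross_coord//=; ring. Qed.

Lemma nat_coord_inj x y : (forall n, (n < 4)%N -> nat_coord x n = nat_coord y n) -> x = y.
Proof. by move=> xy; apply/rowP => i; rewrite !nat_coordE xy. Qed.

(** The right-hand side is the Gram determinant of the three vectors. *)
Lemma dot_cross_cross x y z : dot (cross x y z) (cross x y z) =
    dot x x * (dot y y * dot z z - dot y z ^+ 2)
  - dot x y * (dot x y * dot z z - dot y z * dot x z)
  + dot x z * (dot x y * dot y z - dot y y * dot x z).
Proof.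
rewrite !dot4E !cross_coord//= /minor3.
move: (nat_coord x 0) (nat_coord x 1) (nat_coord x 2) (nat_coord x 3)
  (nat_coord y 0) (nat_coord y 1) (nat_coord y 2) (nat_coord y 3)
  (nat_coord z 0) (nat_coord z 1) (nat_coord z 2) (nat_coord z 3).
by move=> *; ring.
Qed.

Lemma dot_cross1 x y z : dot x (cross x y z) = 0.
Proof. by rewrite dot_cross det_rows4E /minor3; ring. Qed.
Lemma dot_cross2 x y z : dot y (cross x y z) = 0.
Proof. by rewrite dot_cross det_rows4E /minor3; ring. Qed.
Lemma dot_cross3 x y z : dot z (cross x y z) = 0.
Proof. by rewrite dot_cross det_rows4E /minor3; ring. Qed.

Lemma nat_coordD x y n : nat_coord (x + y) n = nat_coord x n + nat_coord y n.
Proof. by rewrite /nat_coord mxE. Qed.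
Lemma nat_coordN x n : nat_coord (- x) n = - nat_coord x n.
Proof. by rewrite /nat_coord mxE. Qed.
Lemma nat_coordZ a x n : nat_coord (a *: x) n = a * nat_coord x n.
Proof. by rewrite /nat_coord mxE. Qed.

(* The velocity produced by the flow, [T x (k N) x (k N)_u]. *)
Lemma cross_flow (t n e : 'rV[R]_4) (k ku tau : R) :
  cross t (k *: n) (ku *: n + k *: (- k *: t - tau *: e)) =
  (k ^+ 2 * tau) *: cross n t e.
Proof.
apply: nat_coord_inj => i i4; rewrite nat_coordZ !cross_coord//.
case: i i4 => [|[|[|[|i]]]]//= _; rewrite /minor3 !(nat_coordD, nat_coordN, nat_coordZ);
  ring.
Qed.

End Space.

(** * Bilinearity and positivity of the inner product *)

Section Dot.
Context {R : realType} {m : nat}.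
Implicit Types (x y z : 'rV[R]_m) (a : R).

Lemma dotC x y : dot x y = dot y x.
Proof. by rewrite !dotE; apply: eq_bigr => j _; exact: mulrC. Qed.

Lemma dotDl x y z : dot (x + y) z = dot x z + dot y z.
Proof. by rewrite /dot mulmxDl mxE. Qed.

Lemma dotZl a x y : dot (a *: x) y = a * dot x y.
Proof. by rewrite /dot -scalemxAl mxE. Qed.

Lemma dotNl x y : dot (- x) y = - dot x y.
Proof. by rewrite /dot mulNmx mxE. Qed.

Lemma dotDr x y z : dot z (x + y) = dot z x + dot z y.
Proof. by rewrite dotC dotDl !(dotC z). Qed.

Lemma dotZr a x y : dot y (a *: x) = a * dot y x.
Proof. by rewrite dotC dotZl dotC. Qed.

Lemma dotNr x y : dot y (- x) = - dot y x.
Proof. by rewrite dotC dotNl dotC. Qed.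

Lemma dot0l x : dot 0 x = 0.
Proof. by rewrite /dot mul0mx mxE. Qed.

Lemma dot_ge0 x : 0 <= dot x x.
Proof. by rewrite dotE; apply: sumr_ge0 => j _; rewrite -expr2 sqr_ge0. Qed.

Lemma dot_eq0 x : (dot x x == 0) = (x == 0).
Proof.
apply/eqP/eqP => [|->]; last exact: dot0l.
rewrite dotE => /eqP; rewrite psumr_eq0 => [/allP x0|j _]; last by rewrite -expr2 sqr_ge0.
apply/rowP => j; rewrite mxE; have /= := x0 j (mem_index_enum j).
by rewrite mulf_eq0 orbb => /eqP.
Qed.

Lemma enorm_sqr x : enorm x ^+ 2 = dot x x.
Proof. by rewrite sqr_sqrtr// dot_ge0. Qed.

Lemma enorm_gt0 x : (0 < enorm x) = (x != 0).
Proof. by rewrite sqrtr_gt0 lt_neqAle dot_ge0 andbT eq_sym dot_eq0. Qed.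

Lemma dot_normalized x : x != 0 ->
  dot ((enorm x)^-1 *: x) ((enorm x)^-1 *: x) = 1.
Proof.
by move=> x0; rewrite dotZl dotZr -enorm_sqr; field; rewrite gt_eqF// enorm_gt0.
Qed.

Definition dotE_linear := (dotDl, dotDr, dotZl, dotZr, dotNl, dotNr).
End Dot.

(** * Frame equations along the u-curves *)

Section Orthonormal.
Context {R : realType}.
Implicit Types (x y : 'rV[R]_4).

Record orthonormal4 (t e d n : 'rV[R]_4) : Prop := Orthonormal4 {
  dot_tt : dot t t = 1; dot_ee : dot e e = 1; dot_dd : dot d d = 1;
  dot_nn : dot n n = 1; dot_te : dot t e = 0; dot_td : dot t d = 0;
  dot_tn : dot t n = 0; dot_ed : dot e d = 0; dot_en : dot e n = 0;
  dot_dn : dot d n = 0 }.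

(** A multirule for rewriting, with the vanishing products in both orders. *)
Lemma orthonormal4_dot t e d n : orthonormal4 t e d n ->
  (((dot t t = 1) * (dot e e = 1) * (dot d d = 1) * (dot n n = 1)) *
  ((dot t e = 0) * (dot t d = 0) * (dot t n = 0) * (dot e d = 0) *
  (dot e n = 0) * (dot d n = 0)) *
  ((dot e t = 0) * (dot d t = 0) * (dot n t = 0) * (dot d e = 0) *
  (dot n e = 0) * (dot n d = 0)))%type.
Proof. by case=> tt ee dd nn te td tn ed en dn; do !split => //; rewrite dotC. Qed.

(** The square matrix [Q] whose rows are the frame vectors has right inverse [Q^T], hence also left
    inverse [Q^T], and [x] equals [x *m Q^T *m Q]. *)
Lemma orthonormal4_expand t e d n x : orthonormal4 t e d n ->
  x = dot x t *: t + dot x e *: e + dot x d *: d + dot x n *: n.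
Proof.
move=> o; pose Q := rows_mx 4 [:: t; e; d; n].
have QQ : Q *m Q^T = 1%:M.
  apply/matrixP => i j; rewrite !mxE.
  transitivity (dot (nth 0 [:: t; e; d; n] i) (nth 0 [:: t; e; d; n] j)).
    by rewrite dotE; apply: eq_bigr => l _; rewrite !mxE.
  rewrite -val_eqE/=.
  by case: i j => [[|[|[|[|i]]]]//= _] [[|[|[|[|j]]]]//= _]; rewrite (orthonormal4_dot o).
rewrite -[LHS]mulmx1 -(mulmx1C QQ) mulmxA mulmx_sum_row.
have E (i : 'I_4) : (x *m Q^T) 0 i = dot x (nth 0 [:: t; e; d; n] i).
  by rewrite mxE dotE; apply: eq_bigr => l _; rewrite !mxE.
under eq_bigr do rewrite E rowK.
by rewrite !big_ord_recl big_ord0 /= addr0 !addrA.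
Qed.

(** The squared length of the product is a Gram determinant, here equal to 1; orthogonality to the
    factors is the vanishing of a determinant with a repeated row. *)
Lemma orthonormal4_cross t e n :
  dot t t = 1 -> dot e e = 1 -> dot n n = 1 ->
  dot t e = 0 -> dot t n = 0 -> dot e n = 0 -> orthonormal4 t e (cross n t e) n.
Proof.
move=> tt ee nn te tn en; split; rewrite ?dot_cross1 ?dot_cross2 ?dot_cross3//; last first.
  by rewrite dotC dot_cross1.
by rewrite dot_cross_cross tt ee nn te (dotC n e) (dotC n t) en tn; ring.
Qed.

End Orthonormal.

(** * The unit normal along a curve on a hypersurface *)

Section Hypersurface.
Context {R : realType}.

Lemma diff_grad m (F : 'rV[R]_m -> R) (x y : 'rV[R]_m) :
  differentiable F x -> 'd F x y = dot y (grad F x).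
Proof.
move=> dF; rewrite {1}(row_sum_delta y) linear_sum dotE; apply: eq_bigr => j _.
by rewrite linearZ /= mxE /pd deriveE.
Qed.

(** Locally the u-curve through [p] stays on the level set of [F], so [F \o Om] vanishes along it;
    by the chain rule its u-derivative is the inner product of [Om_u] with the gradient of [F]. *)
Lemma hypersurface_normal (U : set 'rV[R]_2) (Om : 'rV[R]_2 -> 'rV[R]_4) M nu p :
  open U -> U p -> (forall q, U q -> differentiable Om q) ->
  oriented_hypersurface M nu ->
  (forall q, U q -> q 0 1 = p 0 1 -> M (Om q)) ->
  dot (nu (Om p)) (nu (Om p)) = 1 /\ dot (pd 0 Om p) (nu (Om p)) = 0.
Proof.
move=> oU Up dOm hM MOm.
have Mp := MOm p Up erefl.
have [V [F [oO Op CF MO nuE]]] := hM _ Mp.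
have [g0 ->] := nuE _ (conj Mp Op).
split; first exact: dot_normalized.
have [dF _] := CF.
rewrite dotZr -diff_grad; last exact: dF.
have -> : 'd F (Om p) (pd 0 Om p) = 'D_(delta_mx 0 0) (F \o Om) p.
  rewrite deriveE; last by apply: differentiable_comp; [exact: dOm|exact: dF].
  rewrite (diff_comp (dOm _ Up) (dF _ Op)).
  by rewrite /= /pd deriveE//; exact: dOm.
rewrite (_ : 'D_ _ _ _ = 0) ?mulr0// /derive; apply: cvg_lim => //.
(* The level set equation is available only where the parameter lies in [U] and its image in [V];
   both hold for small [h], and there the difference quotient is zero. *)
have near0 : \forall h \near (0 : R), U (h *: delta_mx 0 0 + p) /\ V (Om (h *: delta_mx 0 0 + p)).
  have cline : (fun h : R => h *: (delta_mx 0 0 : 'rV[R]_2) + p) @ (0 : R) --> p.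
    have : (fun h : R => h *: (delta_mx 0 0 : 'rV[R]_2) + p) @ (0 : R) -->
        (0 : R) *: (delta_mx 0 0 : 'rV[R]_2) + p.
      by apply: cvgD; [apply: cvgZr_tmp; exact: cvg_id | exact: cvg_cst].
    by rewrite scale0r add0r.
  have : \forall q \near p, U q /\ V (Om q).
    apply: filterI; first exact: open_nbhs_nbhs.
    have /differentiable_continuous cOm := dOm _ Up.
    by apply: cOm; exact: open_nbhs_nbhs.
  exact: cline.
have FOm h : U (h *: delta_mx 0 0 + p) -> V (Om (h *: delta_mx 0 0 + p)) ->
    F (Om (h *: delta_mx 0 0 + p)) = 0.
  move=> Uh Oh.
  have : (M `&` V) (Om (h *: delta_mx 0 0 + p)).
    by split => //; apply: MOm => //; rewrite !mxE/= mulr0 add0r.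
  by rewrite MO => -[].
apply: (@cvg_trans _ ((fun=> 0 : R) @ (0 : R)^')); last exact: cvg_cst.
apply: near_eq_cvg; have /cvg_within := near0; move=> near0'.
have Fp : F (Om p) = 0.
  by have := FOm 0; rewrite scale0r add0r; apply.
near=> h.
have [Uh Oh] : U (h *: delta_mx 0 0 + p) /\ V (Om (h *: delta_mx 0 0 + p)).
  by near: h; exact: near0'.
by rewrite /= Fp FOm// subr0 scaler0.
Unshelve. all: by end_near. Qed.

End Hypersurface.

(** * From the ED^2-frame to the frame equations and the velocity *)

Section Frame_equations.
Context {R : realType}.
Variable U : set 'rV[R]_2.
Hypothesis oU : open U.

Lemma Ck_differentiable m (V : normedModType R) n (W : set 'rV[R]_m) (f : 'rV[R]_m -> V) :
  Ck n.+1 W f -> forall p, W p -> differentiable f p.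
Proof. by case. Qed.

Lemma Ck_pd m (V : normedModType R) n (W : set 'rV[R]_m) (f : 'rV[R]_m -> V) i :
  Ck n.+1 W f -> Ck n W (pd i f).
Proof. by case=> _; exact. Qed.

(** The Leibniz rule applied to a constant inner product. *)
Lemma dot_pd_skew m i c (f g : 'rV[R]_2 -> 'rV[R]_m) p :
  (forall q, U q -> differentiable f q) -> (forall q, U q -> differentiable g q) ->
  (forall q, U q -> dot (f q) (g q) = c) -> U p ->
  dot (pd i f p) (g p) = - dot (f p) (pd i g p).
Proof.
move=> df dg fg Up; apply/eqP; rewrite -addr_eq0 -pd_dot; [|exact: df|exact: dg].
by rewrite (eq_pd oU _ fg Up) /pd derive_cst.
Qed.

Lemma dot_pd_sqr m i c (f : 'rV[R]_2 -> 'rV[R]_m) p :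
  (forall q, U q -> differentiable f q) ->
  (forall q, U q -> dot (f q) (f q) = c) -> U p -> dot (pd i f p) (f p) = 0.
Proof.
move=> df ff Up; have := dot_pd_skew i df df ff Up.
by rewrite (dotC (f p)) => /eqP; rewrite -addr_eq0 -mulr2n mulrn_eq0 => /eqP.
Qed.

Record ED_equations (T E D N : 'rV[R]_2 -> 'rV[R]_4) (k s t : 'rV[R]_2 -> R) : Prop := {
  ED_orthonormal : forall p, U p -> orthonormal4 (T p) (E p) (D p) (N p);
  ED_T_u : forall p, U p -> pd 0 T p = k p *: N p;
  ED_E_u : forall p, U p -> pd 0 E p = s p *: D p + t p *: N p;
  ED_D_u : forall p, U p -> pd 0 D p = - s p *: E p;
  ED_N_u : forall p, U p -> pd 0 N p = - k p *: T p - t p *: E p }.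

Variables (Om T E D N : 'rV[R]_2 -> 'rV[R]_4).
Hypotheses (smooth_Om : Ck 7 U Om) (smooth_E : Ck 7 U E) (smooth_D : Ck 7 U D)
  (smooth_N : Ck 7 U N).
Hypothesis Om_unit_speed : forall p, U p -> enorm (pd 0 Om p) = 1.
Hypothesis frame : ED2_frame U Om T E D N.
Hypothesis kappa_neq0 : forall p, U p -> kappa T N p != 0.

Let T_Om p : U p -> T p = pd 0 Om p. Proof. by move=> Up; rewrite (ED2_T frame Up). Qed.

Lemma frame_smooth_T : Ck 6 U T.
Proof.
apply: (eq_Ck oU (f := pd 0 Om)); last exact: Ck_pd _ smooth_Om.
by move=> p Up; rewrite T_Om.
Qed.

Let dT := Ck_differentiable frame_smooth_T.
Let dE := Ck_differentiable smooth_E.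
Let dD := Ck_differentiable smooth_D.
Let dN := Ck_differentiable smooth_N.

Lemma frame_TT p : U p -> dot (T p) (T p) = 1.
Proof. by move=> Up; rewrite T_Om// -enorm_sqr Om_unit_speed// expr1n. Qed.

Lemma frame_NN_TN p : U p -> dot (N p) (N p) = 1 /\ dot (T p) (N p) = 0.
Proof.
move=> Up; have [M [nu [hM MN]]] := ED2_hypersurface frame (p 0 1).
have [_ ->] := MN _ Up erefl; rewrite T_Om//.
apply: hypersurface_normal oU Up _ hM _ => [|q Uq qp]; first exact: Ck_differentiable smooth_Om.
by have [] := MN _ Uq qp.
Qed.

(** In a nontrivial relation [a N + b T + c T_u = 0], the inner product with [T] gives [b = 0] and
    the one with [N] gives [a = - c * kappa]; so [c] is nonzero, otherwise all three coefficients
    would vanish. *)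
Lemma frame_T_u p : U p -> pd 0 T p = kappa T N p *: N p.
Proof.
move=> Up; have [NN TN] := frame_NN_TN Up; have TT := frame_TT Up.
have TuT : dot (pd 0 T p) (T p) = 0 by exact: dot_pd_sqr _ dT frame_TT Up.
have := ED2_dependent frame Up.
rewrite -kermx_eq0 => /rowV0Pn[v /sub_kermxP]; rewrite mulmx_sum_row !big_ord_recl big_ord0 addr0.
rewrite !rowK /= -(eq_pd oU _ T_Om Up).
move va : (v 0 ord0) => a; move vb : (v 0 (lift ord0 ord0)) => b.
move vc : (v 0 (lift ord0 (lift ord0 ord0))) => c E0 v0.
have : dot (a *: N p + (b *: T p + c *: pd 0 T p)) (T p) = 0 by rewrite E0 dot0l.
rewrite !dotE_linear (dotC (N p)) TN TT TuT !mulr0 mulr1 add0r addr0 => b0.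
have : dot (a *: N p + (b *: T p + c *: pd 0 T p)) (N p) = 0 by rewrite E0 dot0l.
rewrite !dotE_linear TN NN !mulr0 mulr1 add0r -/(kappa T N p) => ac.
have c0 : c != 0.
  apply: contra_neq v0 => c0; apply/rowP => i; rewrite mxE.
  move: ac; rewrite c0 mul0r addr0 => a0.
  case: i => -[|[|[|i]]]// i3; [rewrite -a0 -va|rewrite -b0 -vb|rewrite -c0 -vc];
    by congr (v 0 _); exact: val_inj.
apply: (scalerI c0); rewrite scalerA.
move: E0; rewrite b0 scale0r add0r => /eqP; rewrite addr_eq0 => /eqP aN.
have -> : c * kappa T N p = - a by apply/eqP; rewrite -addr_eq0 addrC ac.
by rewrite scaleNr aN opprK.
Qed.

Let res p := ED_residual Om T N p.

(** The residual is a Gram-Schmidt step, orthogonal to [N] and [T]; [D] completes the frame as a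
    vector product. *)
Lemma frame_orthonormal p : U p -> orthonormal4 (T p) (E p) (D p) (N p).
Proof.
move=> Up; have [NN TN] := frame_NN_TN Up; have TT := frame_TT Up.
rewrite (ED2_D frame Up).
have EE : E p = (enorm (res p))^-1 *: res p := ED2_E frame Up.
have resT : dot (T p) (res p) = 0.
  by rewrite /res /ED_residual !dotE_linear TN TT (dotC _ (T p)); ring.
have resN : dot (res p) (N p) = 0.
  by rewrite /res /ED_residual !dotE_linear TN NN; ring.
apply: orthonormal4_cross => //; rewrite EE.
- exact: dot_normalized (ED2_residual_neq0 frame Up).
- by rewrite dotZr resT mulr0.
- by rewrite dotZl resN mulr0.
Qed.

Let TE0 p : U p -> dot (T p) (E p) = 0. Proof. by move=> /frame_orthonormal[]. Qed.
Let EE1 p : U p -> dot (E p) (E p) = 1. Proof. by move=> /frame_orthonormal[]. Qed.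
Let DD1 p : U p -> dot (D p) (D p) = 1. Proof. by move=> /frame_orthonormal[]. Qed.
Let NN1 p : U p -> dot (N p) (N p) = 1. Proof. by move=> /frame_orthonormal[]. Qed.
Let TD0 p : U p -> dot (T p) (D p) = 0. Proof. by move=> /frame_orthonormal[]. Qed.
Let TN0 p : U p -> dot (T p) (N p) = 0. Proof. by move=> /frame_orthonormal[]. Qed.
Let ED0 p : U p -> dot (E p) (D p) = 0. Proof. by move=> /frame_orthonormal[]. Qed.
Let EN0 p : U p -> dot (E p) (N p) = 0. Proof. by move=> /frame_orthonormal[]. Qed.
Let DN0 p : U p -> dot (D p) (N p) = 0. Proof. by move=> /frame_orthonormal[]. Qed.

Lemma frame_smooth_kappa : Ck 5 U (kappa T N).
Proof.
apply: Ck_dot => //; first exact: Ck_pd _ frame_smooth_T.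
exact: Ck_le smooth_N.
Qed.

(* [E] is defined from [T_uu = k_u N + k N_u], so [N_u] has no [D] component. *)
Lemma frame_N_uD p : U p -> dot (pd 0 N p) (D p) = 0.
Proof.
move=> Up; have o := orthonormal4_dot (frame_orthonormal Up).
have EE : E p = (enorm (res p))^-1 *: res p := ED2_E frame Up.
have : dot (res p) (D p) = 0.
  have : dot (E p) (D p) = 0 by rewrite o.
  have e0 : enorm (res p) != 0.
    by rewrite gt_eqF// enorm_gt0; exact: (ED2_residual_neq0 frame Up).
  by rewrite EE dotZl => /eqP; rewrite mulf_eq0 invr_eq0 (negPf e0) => /eqP.
have OmT : pd 0 (pd 0 (pd 0 Om)) p = pd 0 (fun q => kappa T N q *: N q) p.
  apply: (eq_pd oU _ _ Up) => q Uq; rewrite -frame_T_u//.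
  by rewrite (eq_pd oU _ T_Om Uq).
rewrite /res /ED_residual OmT pdZ; [|exact: (Ck_differentiable frame_smooth_kappa Up)|exact: dN].
rewrite !dotE_linear !o !mulr0 !subr0 add0r => /eqP.
by rewrite mulf_eq0 (negPf (kappa_neq0 Up)) => /eqP.
Qed.

(** Each derivative is expanded in the frame. Skew-symmetry of the coefficients, the formula for
    [T_u] and the missing [D] component of [N_u] leave only [kappa], [sigma] and [tau]. *)
Lemma frame_equations : ED_equations T E D N (kappa T N) (sigma E D) (tau E N).
Proof.
have skewu f g c p := @dot_pd_skew 4 0 c f g p.
split; [exact: frame_orthonormal | exact: frame_T_u | | |] => p Up;
  have o := orthonormal4_dot (frame_orthonormal Up).
- rewrite [LHS](orthonormal4_expand _ (frame_orthonormal Up)).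
  rewrite (dot_pd_sqr _ dE EE1 Up) -/(sigma E D p) -/(tau E N p).
  rewrite (dotC _ (T p)) -[dot (T p) _]opprK -(skewu _ _ _ _ dT dE TE0 Up).
  by rewrite frame_T_u// dotZl o mulr0 oppr0 !scale0r !add0r.
- rewrite [LHS](orthonormal4_expand _ (frame_orthonormal Up)).
  rewrite (dot_pd_sqr _ dD DD1 Up).
  rewrite (skewu _ _ _ _ dD dN DN0 Up) (dotC (D p)) frame_N_uD//.
  rewrite (dotC _ (T p)) -[dot (T p) _]opprK -(skewu _ _ _ _ dT dD TD0 Up).
  rewrite (dotC _ (E p)) -[dot (E p) _]opprK -(skewu _ _ _ _ dE dD ED0 Up).
  by rewrite frame_T_u// dotZl o mulr0 oppr0 !scale0r !add0r !addr0.
- rewrite [LHS](orthonormal4_expand _ (frame_orthonormal Up)).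
  rewrite (dot_pd_sqr _ dN NN1 Up) frame_N_uD//.
  rewrite (dotC _ (T p)) -[dot (T p) _]opprK -(skewu _ _ _ _ dT dN TN0 Up).
  rewrite (dotC _ (E p)) -[dot (E p) _]opprK -(skewu _ _ _ _ dE dN EN0 Up).
  by rewrite -/(kappa T N p) -/(tau E N p) !scale0r !addr0 !scaleNr.
Qed.

Lemma flow_velocity p : betchov_da_rios U Om -> U p ->
  pd 1 Om p = Wfun T E N p *: D p.
Proof.
move=> bdr Up; rewrite bdr// -T_Om//.
have T_u q : U q -> pd 0 (pd 0 Om) q = kappa T N q *: N q.
  by move=> Uq; rewrite -frame_T_u// (eq_pd oU _ T_Om Uq).
rewrite T_u// (eq_pd oU _ T_u Up).
rewrite pdZ; [|exact: (Ck_differentiable frame_smooth_kappa Up)|exact: dN].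
by rewrite (ED_N_u frame_equations Up) cross_flow (ED2_D frame Up).
Qed.

End Frame_equations.

(** * Derivatives of the frame along the v-curves *)

Section Scalar_derivation.
Context {R : realType} {m : nat}.
Variables (U : set 'rV[R]_m) (i : 'I_m).
Hypothesis oU : open U.
Implicit Types f g : 'rV[R]_m -> R.

(** Differentiability and the value of the derivative travel together, so that derivatives of
    polynomial expressions can be assembled mechanically. *)
Definition has_pd f f' :=
  forall p, U p -> differentiable f p /\ pd i f p = f' p.

Lemma has_pdD f f' g g' : has_pd f f' -> has_pd g g' ->
  has_pd (fun q => f q + g q) (fun q => f' q + g' q).
Proof.
move=> hf hg p Up; have [[df <-] [dg <-]] := (hf p Up, hg p Up).
by split; [exact: differentiableD | exact: pdD].
Qed.

Lemma has_pdN f f' : has_pd f f' -> has_pd (fun q => - f q) (fun q => - f' q).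
Proof.
move=> hf p Up; have [df <-] := hf p Up.
split; first exact: differentiableN.
by apply: deriveN; exact: diff_derivable.
Qed.

Lemma has_pdM f f' g g' : has_pd f f' -> has_pd g g' ->
  has_pd (fun q => f q * g q) (fun q => f q * g' q + g q * f' q).
Proof.
move=> hf hg p Up; have [[df <-] [dg <-]] := (hf p Up, hg p Up).
by split; [exact: differentiableM | exact: pdM].
Qed.

Lemma has_pd_cst c : has_pd (fun=> c) (fun=> 0).
Proof.
by move=> p Up; split; [exact: differentiable_cst | rewrite /pd derive_cst].
Qed.

Lemma has_pd_eq f f1 f2 : has_pd f f1 -> (forall p, f1 p = f2 p) -> has_pd f f2.
Proof. by move=> hf f12 p Up; rewrite -f12; exact: hf. Qed.

Lemma has_pd_Ck n f : Ck n.+1 U f -> has_pd f (pd i f).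
Proof. by move=> Cf p Up; split => //; exact: (Ck_differentiable Cf Up). Qed.

Lemma pd_comb2 k (a b : 'rV[R]_m -> R) (f g : 'rV[R]_m -> 'rV[R]_k) p :
  differentiable a p -> differentiable b p ->
  differentiable f p -> differentiable g p ->
  pd i (fun q => a q *: f q + b q *: g q) p =
  pd i a p *: f p + a p *: pd i f p + (pd i b p *: g p + b p *: pd i g p).
Proof.
have derZ (c : 'rV[R]_m -> R) (h : 'rV[R]_m -> 'rV[R]_k) : differentiable c p ->
    differentiable h p -> derivable (fun q => c q *: h q) p (delta_mx 0 i).
  move=> dc dh; apply/derivable_mxP => i' j'; rewrite (ord1 i').
  rewrite (_ : (fun x => _) = (fun x => c x * h x 0 j')); last first.
    by apply/funext => q; rewrite mxE.
  by apply: derivableM; apply: diff_derivable; [|exact: differentiable_mx_coord].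
move=> da db df dg; rewrite -(pdZ i da df) -(pdZ i db dg).
by apply: deriveD; exact: derZ.
Qed.

End Scalar_derivation.

(** Recursion on the shape of the expression. The derivative starts as an existential variable that
    the rules fill in; [ring] then compares it with the intended formula. *)
Ltac has_pd_tac := lazymatch goal with
  | |- has_pd _ _ (fun q => @?f q + @?g q) _ => eapply (@has_pdD _ _ _ _ f _ g _); has_pd_tac
  | |- has_pd _ _ (fun q => - @?f q) _ => eapply (@has_pdN _ _ _ _ f _); has_pd_tac
  | |- has_pd _ _ (fun q => @?f q * @?g q) _ => eapply (@has_pdM _ _ _ _ f _ g _); has_pd_tac
  | |- has_pd _ _ (fun=> ?c) _ => exact: has_pd_cst
  | |- _ => eassumption
  end.

Section Area.
Context {R : realType} {m : nat}.
Variables (U : set 'rV[R]_m) (i : 'I_m) (k k1 k2 k3 t t1 t2 t3 : 'rV[R]_m -> R).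
Hypotheses (hk : has_pd U i k k1) (hk1 : has_pd U i k1 k2) (hk2 : has_pd U i k2 k3).
Hypotheses (ht : has_pd U i t t1) (ht1 : has_pd U i t1 t2) (ht2 : has_pd U i t2 t3).

(** [area1], [area2] and [area3] are the first three derivatives of [k * k * t], the area density of
    the surface up to sign, written in the derivatives of [k] and [t]. *)
Definition area1 q := 2 * k q * k1 q * t q + k q * k q * t1 q.
Definition area2 q :=
  2 * k1 q * k1 q * t q + 2 * k q * k2 q * t q + 4 * k q * k1 q * t1 q + k q * k q * t2 q.
Definition area3 q :=
  6 * k1 q * k2 q * t q + 2 * k q * k3 q * t q + 6 * k1 q * k1 q * t1 q
  + 6 * k q * k2 q * t1 q + 6 * k q * k1 q * t2 q + k q * k q * t3 q.

Lemma has_pd_area : has_pd U i (fun q => k q * k q * t q) area1.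
Proof.
by apply: has_pd_eq => [|p]; [has_pd_tac | rewrite /area1; ring].
Qed.

Lemma has_pd_area1 : has_pd U i area1 area2.
Proof.
by apply: has_pd_eq => [|p]; [rewrite /area1; has_pd_tac | rewrite /area2; ring].
Qed.

Lemma has_pd_area2 : has_pd U i area2 area3.
Proof.
apply: has_pd_eq => [|p].
rewrite /area2; has_pd_tac.
rewrite /area3; ring.
Qed.

End Area.

(** * Compatibility of the mixed derivatives of the frame *)

Section Flow.
Context {R : realType}.
Variables (U : set 'rV[R]_2) (T E D N : 'rV[R]_2 -> 'rV[R]_4) (k s t : 'rV[R]_2 -> R).
Hypothesis oU : open U.
Hypotheses (CT : Ck 6 U T) (CE : Ck 7 U E) (CD : Ck 7 U D) (CN : Ck 7 U N).
Hypotheses (Ck_k : Ck 5 U k) (Ck_s : Ck 5 U s) (Ck_t : Ck 5 U t).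
Hypothesis eqs : ED_equations U T E D N k s t.
Hypotheses (k0 : forall p, U p -> k p != 0) (t0 : forall p, U p -> t p != 0).

Let W q := k q * k q * t q.
(* [T_v = Om_uv = (W D)_u] *)
Hypothesis T_v : forall p, U p -> pd 1 T p = pd 0 (fun q => W q *: D q) p.

Let k1 := pd 0 k. Let k2 := pd 0 k1. Let k3 := pd 0 k2.
Let t1 := pd 0 t. Let t2 := pd 0 t1. Let t3 := pd 0 t2.
Let s1 := pd 0 s.
Let W1 := area1 k k1 t t1.
Let W2 := area2 k k1 k2 t t1 t2.
Let W3 := area3 k k1 k2 k3 t t1 t2 t3.

Let hk : has_pd U 0 k k1 := has_pd_Ck 0 Ck_k.
Let hk1 : has_pd U 0 k1 k2 := has_pd_Ck 0 (Ck_pd 0 Ck_k).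
Let hk2 : has_pd U 0 k2 k3 := has_pd_Ck 0 (Ck_pd 0 (Ck_pd 0 Ck_k)).
Let ht : has_pd U 0 t t1 := has_pd_Ck 0 Ck_t.
Let ht1 : has_pd U 0 t1 t2 := has_pd_Ck 0 (Ck_pd 0 Ck_t).
Let ht2 : has_pd U 0 t2 t3 := has_pd_Ck 0 (Ck_pd 0 (Ck_pd 0 Ck_t)).
Let hs : has_pd U 0 s s1 := has_pd_Ck 0 Ck_s.

Let hW : has_pd U 0 W W1. Proof. exact: has_pd_area hk ht. Qed.
Let hW1 : has_pd U 0 W1 W2. Proof. exact: has_pd_area1 hk hk1 ht ht1. Qed.
Let hW2 : has_pd U 0 W2 W3. Proof. exact: has_pd_area2 hk hk1 hk2 ht ht1 ht2. Qed.

Let dT := Ck_differentiable CT.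
Let dE := Ck_differentiable CE.
Let dD := Ck_differentiable CD.
Let dN := Ck_differentiable CN.

Lemma flow_T_v p : U p -> pd 1 T p = W1 p *: D p - (W p * s p) *: E p.
Proof.
move=> Up; have [dW <-] := hW Up; rewrite T_v// pdZ//; last exact: dD.
by rewrite (ED_D_u eqs Up) scaleNr scalerN scalerA.
Qed.

Let o p (Up : U p) := orthonormal4_dot (ED_orthonormal eqs Up).

Let alpha q := dot (pd 1 N q) (E q).
Let beta q := dot (pd 1 N q) (D q).

(** Equality of the mixed derivatives of [T]: the left side differentiates [T_u = k N] along v, the
    right side differentiates [T_v] along u. Its [E] and [D] components determine [alpha] and
    [beta]. *)
Let N_vu p : U p -> pd 1 k p *: N p + k p *: pd 1 N p =
  W2 p *: D p + W1 p *: (- s p *: E p)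
  + ((- (W p * s1 p + s p * W1 p)) *: E p
     + (- (W p * s p)) *: (s p *: D p + t p *: N p)).
Proof.
move=> Up; have [dk _] := hk Up.
have hWs : has_pd U 0 (fun q => - (W q * s q)) (fun q => - (W q * s1 q + s q * W1 q)).
  by has_pd_tac.
have [dWs <-] := hWs p Up; have [dW1 <-] := hW1 Up.
rewrite -(pdZ 1 dk (dN Up)).
rewrite -(ED_D_u eqs Up) -(ED_E_u eqs Up).
rewrite -(pd_comb2 0 dW1 dWs (dD Up) (dE Up)).
rewrite -(eq_pd oU 1 (ED_T_u eqs) Up).
rewrite (pd_comm oU 1 0 (Ck_le (k := 2) (n := 6) isT CT) Up).
apply: (eq_pd oU 0 _ Up) => q Uq.
by rewrite flow_T_v// scaleNr.
Qed.

Lemma flow_N_vE p : U p -> k p * alpha p = - (2 * W1 p * s p + W p * s1 p).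
Proof.
move=> Up; have := congr1 (fun x => dot x (E p)) (N_vu Up).
rewrite /alpha !dotE_linear !(o Up) => H.
by move: H; rewrite mulr0 add0r => ->; ring.
Qed.

Lemma flow_N_vD p : U p -> k p * beta p = W2 p - W p * s p ^+ 2.
Proof.
move=> Up; have := congr1 (fun x => dot x (D p)) (N_vu Up).
rewrite /beta !dotE_linear !(o Up) => H.
by move: H; rewrite mulr0 add0r => ->; ring.
Qed.

(** [N_v] has no [N] component since [N] has constant length, and none along [T] since [T_v] has no
    [N] component. *)
Lemma flow_N_v p : U p -> pd 1 N p = alpha p *: E p + beta p *: D p.
Proof.
move=> Up; rewrite [LHS](orthonormal4_expand _ (ED_orthonormal eqs Up)).
have NN q : U q -> dot (N q) (N q) = 1 by move=> Uq; rewrite (o Uq).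
have TN q : U q -> dot (T q) (N q) = 0 by move=> Uq; rewrite (o Uq).
rewrite (dot_pd_sqr oU _ dN NN Up).
rewrite (dotC _ (T p)) -[dot (T p) _]opprK -(dot_pd_skew oU _ dT dN TN Up).
by rewrite flow_T_v// !dotE_linear !(o Up) !mulr0 subrr oppr0 !scale0r add0r addr0.
Qed.

(** The [D] component of the equality of the mixed derivatives of [N]. *)
Lemma flow_E_vD p : U p ->
  t p * dot (pd 1 E p) (D p) = - (alpha p * s p + pd 0 beta p + k p * W1 p).
Proof.
move=> Up.
have Calpha : Ck 6 U alpha.
  by apply: Ck_dot; [exact: oU| exact: Ck_pd _ CN | exact: Ck_le CE].
have Cbeta : Ck 6 U beta.
  by apply: Ck_dot; [exact: oU| exact: Ck_pd _ CN | exact: Ck_le CD].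
have da := Ck_differentiable Calpha Up.
have db := Ck_differentiable Cbeta Up.
have [dk _] := hk Up; have [dt _] := ht Up.
have Nuv : pd 1 (fun q => (- k q) *: T q + (- t q) *: E q) p =
    pd 0 (fun q => alpha q *: E q + beta q *: D q) p.
  transitivity (pd 1 (pd 0 N) p).
    apply: (eq_pd oU 1 _ Up) => q Uq.
    by rewrite (ED_N_u eqs Uq) !scaleNr.
  rewrite (pd_comm oU 1 0 (Ck_le (k := 2) (n := 7) isT CN) Up).
  by apply: (eq_pd oU 0 _ Up) => q Uq; rewrite flow_N_v.
have := congr1 (fun x => dot x (D p)) Nuv.
rewrite (pd_comb2 1 (a := fun q => - k q) (b := fun q => - t q) (differentiableN dk)
  (differentiableN dt) (dT Up) (dE Up)).
rewrite (pd_comb2 0 da db (dE Up) (dD Up)).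
rewrite (ED_D_u eqs Up) (ED_E_u eqs Up) flow_T_v//.
rewrite !dotE_linear !(o Up) => H.
apply/eqP; rewrite -subr_eq0; apply/eqP.
by move/eqP: H; rewrite -subr_eq0 => /eqP H; rewrite -[RHS]oppr0 -H; ring.
Qed.

(** The u-derivative of [flow_N_vD], kept in product form so that no quotient has to be
    differentiated. *)
Lemma flow_beta_u p : U p ->
  k1 p * beta p + k p * pd 0 beta p = W3 p - (W1 p * s p ^+ 2 + 2 * W p * s p * s1 p).
Proof.
move=> Up.
have Cbeta : Ck 6 U beta.
  by apply: Ck_dot; [exact: oU| exact: Ck_pd _ CN | exact: Ck_le CD].
have hb := has_pd_Ck 0 Cbeta.
have [_ <-] : differentiable (fun q => k q * beta q) p /\
    pd 0 (fun q => k q * beta q) p = k1 p * beta p + k p * pd 0 beta p.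
  by have [d ->] := has_pdM hk hb Up; split => //; rewrite addrC mulrC.
have : has_pd U 0 (fun q => W2 q + - (W q * (s q * s q)))
    (fun q => W3 q - (W1 q * s q ^+ 2 + 2 * W q * s q * s1 q)).
  by apply: has_pd_eq; [has_pd_tac | move=> q /=; ring].
move=> /(_ p Up)[_ <-]; apply: (eq_pd oU 0 _ Up) => q Uq.
by rewrite flow_N_vD// expr2.
Qed.

Lemma a34E p : U p -> a34 k s t p = - beta p.
Proof.
move=> Up; have -> : beta p = (W2 p - W p * s p ^+ 2) / k p.
  by rewrite -flow_N_vD// mulrC mulKf// k0.
have := k0 Up; cbv zeta beta delta [a34 W2 area2 W k2 k1 t2 t1].
generalize (pd 0 (pd 0 k) p) (pd 0 k p) (k p) (pd 0 (pd 0 t) p) (pd 0 t p) (t p) (s p).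
by move=> *; field.
Qed.

(** Successive elimination of [E_v], [beta_u], [beta] and [alpha] through the compatibility
    equations leaves a rational identity in the u-derivatives of [k], [s] and [t]. *)
Lemma a23E p : U p -> a23 k s t p = dot (pd 1 E p) (D p).
Proof.
move=> Up; have kp := k0 Up; have tp := t0 Up.
have -> : dot (pd 1 E p) (D p) = - (alpha p * s p + pd 0 beta p + k p * W1 p) / t p.
  by rewrite -flow_E_vD// mulrC mulKf.
have -> : pd 0 beta p = (W3 p - (W1 p * s p ^+ 2 + 2 * W p * s p * s1 p)
    - k1 p * beta p) / k p.
  apply: (canRL (mulfK kp)); rewrite mulrC; apply/eqP.
  by rewrite eq_sym subr_eq [X in _ == X]addrC eq_sym; apply/eqP; exact: (flow_beta_u Up).
have -> : beta p = (W2 p - W p * s p ^+ 2) / k p.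
  by apply: (canRL (mulfK kp)); rewrite mulrC; exact: (flow_N_vD Up).
have -> : alpha p = - (2 * W1 p * s p + W p * s1 p) / k p.
  by rewrite -flow_N_vE// mulrC mulKf.
move: kp tp; cbv zeta beta delta [a23 W3 W2 W1 area3 area2 area1 W k3 k2 k1 t3 t2 t1 s1].
(* The derivatives become independent variables, so that [field] treats a plain rational
   identity. *)
generalize (pd 0 (pd 0 (pd 0 k)) p) (pd 0 (pd 0 k) p) (pd 0 k p) (k p)
  (pd 0 (pd 0 (pd 0 t)) p) (pd 0 (pd 0 t) p) (pd 0 t p) (t p) (pd 0 s p) (s p).
by move=> *; field; apply/andP.
Qed.

End Flow.

(** * The second fundamental form *)

Lemma sum_ord2 (V : nmodType) (F : 'I_2 -> V) : \sum_i F i = F 0 + F 1.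
Proof.
by rewrite !big_ord_recl big_ord0 addr0; congr (_ + F _); exact: val_inj.
Qed.

Lemma sum_ord22 (V : nmodType) (F : 'I_2 -> 'I_2 -> V) :
  \sum_i \sum_j F i j = F 0 0 + F 0 1 + (F 1 0 + F 1 1).
Proof. by rewrite sum_ord2 !sum_ord2. Qed.

Lemma ord2P (P : 'I_2 -> Prop) : P 0 -> P 1 -> forall i, P i.
Proof.
move=> P0 P1 i; have [->//|->//] : i = 0 \/ i = 1.
by case: i => [[|[|i]]]// i2; [left|right]; exact: val_inj.
Qed.

Section Tangent.
Context {R : realType}.
Variables (Om : 'rV[R]_2 -> 'rV[R]_4) (p : 'rV[R]_2).
Let A := tangent_mx Om p.

Lemma metricE : metric Om p = A *m A^T.
Proof.
by apply/matrixP => i j; rewrite !mxE dotE; apply: eq_bigr => l _; rewrite !mxE.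
Qed.

Lemma tangent_mx_comb (c : 'rV[R]_2) :
  c *m A = c 0 0 *: pd 0 Om p + c 0 1 *: pd 1 Om p.
Proof.
by rewrite mulmx_sum_row sum_ord2 !rowK.
Qed.

(** [A^T (A A^T)^-1] is a right inverse of [A], and [A^T] kills the normal vector [x]. *)
Lemma tangent_coord_decomp (c : 'rV[R]_2) (x : 'rV[R]_4) :
  metric Om p \in unitmx -> (forall i, dot x (pd i Om p) = 0) ->
  tangent_coord Om p (c *m A + x) = c.
Proof.
rewrite metricE => uA xA; rewrite /tangent_coord -/A mulmxDl -(mulmxA c).
rewrite (_ : x *m A^T = 0) ?addr0 ?mulmxK//.
apply/rowP => i; rewrite !mxE -[RHS](xA i) dotE.
by apply: eq_bigr => l _; rewrite !mxE.
Qed.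

Variables (t e d n : 'rV[R]_4) (w : R).
Hypotheses (o : orthonormal4 t e d n) (w0 : w != 0).
Hypotheses (Om_u : pd 0 Om p = t) (Om_v : pd 1 Om p = w *: d).
Let oE := orthonormal4_dot o.

Lemma metric_orthonormal (i j : 'I_2) :
  metric Om p i j = if i == j then (if i == 0 then 1 else w ^+ 2) else 0.
Proof.
rewrite mxE; move: i j; apply: ord2P; apply: ord2P; rewrite /= ?Om_u ?Om_v ?dotE_linear ?oE ?mulr0//.
by rewrite mulr1 expr2.
Qed.

Lemma det_metric : \det (metric Om p) = w ^+ 2.
Proof.
rewrite (_ : metric Om p = diag_mx (\row_j (if j == 0 then 1 else w ^+ 2))).
  by rewrite det_diag !big_ord_recl big_ord0 !mxE/= mul1r mulr1.
apply/matrixP => i j; rewrite metric_orthonormal !mxE.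
by have [->|] := eqVneq i j; rewrite ?mulr1n ?mulr0n.
Qed.

Lemma metric_unit : metric Om p \in unitmx.
Proof. by rewrite unitmxE det_metric unitfE expf_neq0. Qed.

Lemma inv_metric (i j : 'I_2) :
  invmx (metric Om p) i j = if i == j then (if i == 0 then 1 else (w ^+ 2)^-1) else 0.
Proof.
pose G : 'M[R]_2 := \matrix_(i, j) if i == j then (if i == 0 then 1 else (w ^+ 2)^-1) else 0.
have MG : metric Om p *m G = 1%:M.
  apply/matrixP => a b; rewrite !mxE sum_ord2 !metric_orthonormal !mxE.
  move: a b; apply: ord2P; apply: ord2P; rewrite /= ?mulr0 ?mul0r ?addr0 ?add0r ?mulr1//.
  by rewrite mulfV// expf_neq0.
rewrite (_ : invmx _ = G) ?mxE// -[LHS]mulmx1 -MG mulmxA mulVmx ?mul1mx//.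
exact: metric_unit.
Qed.

(** The coordinates refer to the basis [(t, w *: d)], whence the division by [w]. *)
Lemma tangent_coord_orthonormal (x y z c : R) :
  tangent_coord Om p (x *: t + y *: d + (z *: e + c *: n)) =
  \row_j (if j == 0 then x else y / w).
Proof.
set r := \row_j _.
have -> : x *: t + y *: d = r *m A.
  by rewrite tangent_mx_comb !mxE /= Om_u Om_v scalerA divfK.
apply: tangent_coord_decomp; first exact: metric_unit.
by apply: ord2P; rewrite ?Om_u ?Om_v !dotE_linear !oE; ring.
Qed.

Lemma normal_part_orthonormal x :
  normal_part Om p x = dot x e *: e + dot x n *: n.
Proof.
have E : x = dot x t *: t + dot x d *: d + (dot x e *: e + dot x n *: n).
  by rewrite {1}(orthonormal4_expand x o) addrA [_ + _ *: e + _]addrAC.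
rewrite /normal_part {1 2}E tangent_coord_orthonormal -/A tangent_mx_comb !mxE/=.
by rewrite Om_u Om_v scalerA divfK// addrC addKr.
Qed.

Variables (k s a b : R).
Hypotheses
  (He : forall i j : 'I_2, dot (pd i (pd j Om) p) e =
     nth 0 (nth [::] [:: [:: 0; - (w * s)]; [:: - (w * s); - (w * a)]] i) j)
  (Hn : forall i j : 'I_2, dot (pd i (pd j Om) p) n =
     nth 0 (nth [::] [:: [:: k; 0]; [:: 0; w * b]] i) j).

(** Each component along [d] contributes a factor [w^-1], which turns the entries [w * s], [w * a]
    and [w * b] of the second derivatives into [s], [a / w] and [b / w]. *)
Lemma second_fundamental_form_orthonormal x y x' y' :
  second_fundamental_form Om p (x *: t + y *: d) (x' *: t + y' *: d) =
  (- (x * y' + y * x') * s - y * y' * (a / w)) *: e +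
  (x * x' * k + y * y' * (b / w)) *: n.
Proof.
have E z z' : tangent_coord Om p (z *: t + z' *: d) = \row_j (if j == 0 then z else z' / w).
  by rewrite -(tangent_coord_orthonormal _ _ 0 0) !scale0r !addr0.
rewrite /second_fundamental_form !E normal_part_orthonormal.
have dotS (c : 'I_2 -> 'I_2 -> R) (f : 'I_2 -> 'I_2 -> 'rV[R]_4) v :
    dot (\sum_i \sum_j c i j *: f i j) v = \sum_i \sum_j c i j * dot (f i j) v.
  have dot_sum := big_morph (fun x => dot x v) (fun x y => dotDl x y v) (dot0l v).
  rewrite dot_sum; apply: eq_bigr => i _; rewrite dot_sum.
  by apply: eq_bigr => j _; rewrite dotZl.
rewrite !dotS; under eq_bigr do under eq_bigr do rewrite He.
under [X in _ + X *: n]eq_bigr do under eq_bigr do rewrite Hn.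
by rewrite !sum_ord22 !mxE /=; congr (_ *: e + _ *: n); field.
Qed.

Lemma curvature_ellipse_orthonormal v : curvature_ellipse Om p v <->
  exists x y, x ^+ 2 + y ^+ 2 = 1 /\
    v = (- (2 * x * y) * s - y ^+ 2 * (a / w)) *: e + (x ^+ 2 * k + y ^+ 2 * (b / w)) *: n.
Proof.
have nE x y : dot (x *: t + y *: d) (x *: t + y *: d) = x ^+ 2 + y ^+ 2.
  by rewrite !dotE_linear !oE; ring.
split=> [[X [/submxP[c ->]]]|[x [y [xy ->]]]].
  rewrite tangent_mx_comb Om_u Om_v scalerA => X1 <-.
  exists (c 0 0), (c 0 1 * w); split; first by rewrite -nE -enorm_sqr X1 expr1n.
  by rewrite second_fundamental_form_orthonormal; congr (_ *: e + _ *: n); ring.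
exists (x *: t + y *: d); last first.
  by rewrite second_fundamental_form_orthonormal; congr (_ *: e + _ *: n); ring.
split; last by rewrite /enorm nE xy sqrtr1.
apply/submxP; exists (\row_j (if j == 0 then x else y / w)).
by rewrite tangent_mx_comb !mxE/= Om_u Om_v scalerA divfK.
Qed.

End Tangent.

(** * The curvature ellipse *)

Section Convex_hull.
Context {R : realType}.
Implicit Types (S : set 'rV[R]_4) (x y l : 'rV[R]_4) (a : R).

(** The open half-space is convex and contains [S] but not the origin. *)
Lemma convex_hull_halfspace S l :
  (forall x, S x -> 0 < dot x l) -> ~ convex_hull S 0.
Proof.
move=> Sl; have : convex_set [set x | 0 < dot x l].
  apply/convex_setW => x y; rewrite !inE /= => xl yl a a0 a1; rewrite inE/=.
  rewrite [X in dot X _](_ : _ = a%:num *: (x : 'rV[R]_4) + (1 - a%:num) *: (y : 'rV[R]_4))//.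
  by rewrite dotDl !dotZl addr_gt0// mulr_gt0// subr_gt0.
by move=> cH /(_ [set x | 0 < dot x l] (conj cH Sl)); rewrite /= dot0l ltxx.
Qed.

Lemma convex_hull_segment S x y a : 0 <= a -> a <= 1 -> S x -> S y ->
  convex_hull S (a *: x + (1 - a) *: y).
Proof.
move=> a0 a1 Sx Sy C [cC SC].
have := cC x y (Itv01 a0 a1); rewrite !inE => /(_ (SC _ Sx) (SC _ Sy)).
by [].
Qed.

(** The origin is the combination of [a *: x] and [b *: x] with weight [b / (b - a)] on the first, a
    number of [[0, 1]] because the signs are opposite. *)
Lemma convex_hull_opposite S x a b : a * b < 0 -> S (a *: x) -> S (b *: x) ->
  convex_hull S 0.
Proof.
move=> ab Sa Sb.
have ba : b - a != 0.
  by apply: contraTneq ab => /eqP; rewrite subr_eq0 => /eqP ->; rewrite -expr2 -leNgt sqr_ge0.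
have -> : 0 = (b / (b - a)) *: (a *: x) + (1 - b / (b - a)) *: (b *: x).
  by rewrite !scalerA -scalerDl (_ : _ + _ = 0) ?scale0r//; field.
have [/andP[a0 b0]|/andP[b0 a0]] : a < 0 < b \/ b < 0 < a.
  move: ab; case: (ltrgt0P a) => a0; last by rewrite a0 mul0r ltxx.
    by rewrite pmulr_rlt0// => ->; right.
  by rewrite nmulr_rlt0// => ->; left.
- have d0 : 0 < b - a by lra.
  by apply: convex_hull_segment => //; rewrite ?ler_pdivlMr ?ler_pdivrMr//; lra.
- have d0 : b - a < 0 by lra.
  by apply: convex_hull_segment => //; rewrite ?ler_ndivlMr ?ler_ndivrMr//; lra.
Qed.

End Convex_hull.

(* At a point, the curvature ellipse consists of the values on the unit circle
   of the pair of quadratic forms [- 2 x y s - y ^+ 2 a] and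
   [x ^+ 2 k + y ^+ 2 b]. *)
Section Quadratic_forms.
Context {R : realType}.
Variables (k s a b : R).
Hypothesis k0 : k != 0.

Lemma definite_combination : 0 < k * (k * a ^+ 2 + 4 * s ^+ 2 * b) ->
  exists l, forall x y, x ^+ 2 + y ^+ 2 = 1 ->
    0 < l * (- (2 * x * y) * s - y ^+ 2 * a) + k * (x ^+ 2 * k + y ^+ 2 * b).
Proof.
move=> q0; have k2 : 0 < k ^+ 2 by rewrite exprn_even_gt0.
have [s0|s0] := eqVneq s 0.
  have a0 : a != 0 by apply: contraTneq q0 => ->; rewrite s0 !(mulr0, mul0r, expr0n)/= addr0 mulr0 ltxx.
  (* When [s = 0] this multiplier makes the coefficient of [y ^+ 2] equal to 1. *)
  exists ((k * b - 1) / a) => x y xy.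
  rewrite [X in 0 < X](_ : _ = k ^+ 2 * x ^+ 2 + y ^+ 2); last by rewrite s0; field.
  have [y0|y0] := eqVneq y 0; last first.
    by apply: ltr_wpDl; [rewrite mulr_ge0 ?sqr_ge0 | rewrite exprn_even_gt0].
  by move: xy; rewrite y0 expr0n/= !addr0 => ->; rewrite mulr1.
(* After completing the square in [x], the remaining coefficient of [y ^+ 2] is a concave quadratic
   in [l]; this is its maximiser. *)
exists (- (k ^+ 2 * a / (2 * s ^+ 2))) => x y xy.
rewrite [X in 0 < X](_ : _ = (k * x + k * a * y / (2 * s)) ^+ 2 +
   y ^+ 2 * (k * (k * a ^+ 2 + 4 * s ^+ 2 * b) / (4 * s ^+ 2))); last by field.
have [y0|y0] := eqVneq y 0.
  move: xy; rewrite y0 !(mulr0, mul0r, expr0n)/= ?mul0r ?addr0 exprMn => ->.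
  by rewrite mulr1.
apply: ltr_wpDl; first exact: sqr_ge0.
by rewrite mulr_gt0 ?exprn_even_gt0// divr_gt0// mulr_gt0// exprn_even_gt0.
Qed.

(** A common zero has [y != 0], since [y = 0] would give [k = 0]; eliminating [x] then makes the
    discriminant vanish. *)
Lemma zero_outside_ellipse x y : k * (k * a ^+ 2 + 4 * s ^+ 2 * b) < 0 ->
  x ^+ 2 + y ^+ 2 = 1 -> - (2 * x * y) * s - y ^+ 2 * a = 0 ->
  x ^+ 2 * k + y ^+ 2 * b = 0 -> False.
Proof.
move=> q0 xy e0 n0.
have y0 : y != 0.
  apply/negP => /eqP y0; move: xy n0; rewrite y0 expr0n/= addr0 mul0r addr0 => ->.
  by rewrite mul1r => /eqP; apply/negP.
have xs : 2 * x * s = - (y * a).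
  apply: (mulfI y0); apply/eqP; rewrite -subr_eq0 -oppr_eq0; apply/eqP.
  by apply: etrans e0; ring.
have : y ^+ 2 * (k * a ^+ 2 + 4 * s ^+ 2 * b) = 0.
  have -> : y ^+ 2 * (k * a ^+ 2 + 4 * s ^+ 2 * b) =
      k * (- (y * a)) ^+ 2 + 4 * s ^+ 2 * (y ^+ 2 * b) by ring.
  rewrite -xs (_ : y ^+ 2 * b = - (x ^+ 2 * k)); first by ring.
  by apply/eqP; rewrite -addr_eq0 addrC n0.
move/eqP; rewrite mulf_eq0 expf_eq0/= (negPf y0)/= => /eqP E.
by move: q0; rewrite E mulr0 ltxx.
Qed.

(** The first form is [- y * (2 * x * s + y * a)]. Besides [y = 0], where the second form has the
    sign of [k], it vanishes along [(a, - 2 * s)]; the witness is this vector normalised by [r]. *)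
Lemma opposite_points : k * (k * a ^+ 2 + 4 * s ^+ 2 * b) < 0 ->
  exists x y, [/\ x ^+ 2 + y ^+ 2 = 1, - (2 * x * y) * s - y ^+ 2 * a = 0 &
    k * (x ^+ 2 * k + y ^+ 2 * b) < 0].
Proof.
move=> q0; have s0 : s != 0.
  apply: contraTneq q0 => ->; rewrite expr0n/= mulr0 mul0r addr0 mulrA -expr2 -exprMn.
  by rewrite -leNgt sqr_ge0.
have r0 : 0 < a ^+ 2 + 4 * s ^+ 2 by apply: ltr_wpDl; [exact: sqr_ge0 | rewrite mulr_gt0// exprn_even_gt0].
pose r := (Num.sqrt (a ^+ 2 + 4 * s ^+ 2))^-1.
have r2 : r ^+ 2 = (a ^+ 2 + 4 * s ^+ 2)^-1 by rewrite exprVn sqr_sqrtr// ltW.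
exists (r * a), (- (2 * r * s)); split.
- rewrite (_ : _ + _ = r ^+ 2 * (a ^+ 2 + 4 * s ^+ 2)); last by ring.
  by rewrite r2 mulVf// gt_eqF.
- by ring.
- rewrite (_ : k * _ = r ^+ 2 * (k * (k * a ^+ 2 + 4 * s ^+ 2 * b))); last by ring.
  by rewrite pmulr_rlt0// r2 invr_gt0.
Qed.

End Quadratic_forms.

(** * Classification at a point from the second derivatives *)

Section Point.
Context {R : realType}.
Variables (Om T E N : 'rV[R]_2 -> 'rV[R]_4) (d : 'rV[R]_4) (p : 'rV[R]_2).
Let w := Wfun T E N p.
Variables (k s a b : R).
Hypotheses (o : orthonormal4 (T p) (E p) d (N p)) (w0 : w != 0) (k0 : k != 0).
Hypotheses (Om_u : pd 0 Om p = T p) (Om_v : pd 1 Om p = w *: d).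
Hypotheses
  (He : forall i j : 'I_2, dot (pd i (pd j Om) p) (E p) =
     nth 0 (nth [::] [:: [:: 0; - (w * s)]; [:: - (w * s); - (w * a)]] i) j)
  (Hn : forall i j : 'I_2, dot (pd i (pd j Om) p) (N p) =
     nth 0 (nth [::] [:: [:: k; 0]; [:: 0; w * b]] i) j).
Let q := k * (a / w) ^+ 2 + 4 * s ^+ 2 * (b / w).

Let oE := orthonormal4_dot o.
Let ellipseP := curvature_ellipse_orthonormal o w0 Om_u Om_v He Hn.
Let sffE := second_fundamental_form_orthonormal o w0 Om_u Om_v He Hn.

(** The positive combination is the inner product with [l *: E p + k *: N p], so the ellipse lies in
    an open half-space. *)
Lemma ellipse_outside : 0 < k * q -> outside_curvature_ellipse Om p.
Proof.
move=> /(definite_combination k0)[l lP].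
apply: (@convex_hull_halfspace _ _ (l *: E p + k *: N p)) => x /ellipseP[y [z [yz ->]]].
apply: (lt_le_trans (lP _ _ yz)); rewrite le_eqVlt; apply/predU1P; left.
by rewrite !dotE_linear !oE; ring.
Qed.

(** The direction [T] gives the point [k *: N p], and [opposite_points] gives one on the opposite
    ray; the origin lies between them. *)
Lemma ellipse_inside : k * q < 0 -> inside_curvature_ellipse Om p.
Proof.
move=> kq; split.
  have [x [y [xy e0 n0]]] := opposite_points kq.
  apply: (convex_hull_opposite (x := N p) n0); apply/ellipseP.
    exists 1, 0; split; first by rewrite expr0n addr0 expr1n.
    by rewrite -[LHS]add0r; congr (_ + _ *: _); [rewrite -[LHS](scale0r (E p)); congr (_ *: _)|]; ring.
  by exists x, y; split => //; rewrite e0 scale0r add0r.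
move=> /ellipseP[x [y [xy /esym E0]]].
apply: (zero_outside_ellipse k0 kq xy).
  by have := congr1 (fun v => dot v (E p)) E0; rewrite !dotE_linear !oE dot0l mulr0 mulr1 addr0.
by have := congr1 (fun v => dot v (N p)) E0; rewrite !dotE_linear !oE dot0l mulr0 mulr1 add0r.
Qed.

Let hE (x y x' y' : R) (X Y : 'rV[R]_4) : X = x *: T p + y *: d -> Y = x' *: T p + y' *: d ->
  dot (second_fundamental_form Om p X Y) (E p) = - (x * y' + y * x') * s - y * y' * (a / w) /\
  dot (second_fundamental_form Om p X Y) (N p) = x * x' * k + y * y' * (b / w).
Proof.
by move=> -> ->; rewrite sffE !dotE_linear !oE !mulr0 !mulr1 addr0 add0r.
Qed.

Let X1E : X1 Om p = 1 *: T p + 0 *: d.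
Proof. by rewrite scale1r scale0r addr0. Qed.
Let X2E : X2 Om T E N p = 0 *: T p + 1 *: d.
Proof. by rewrite scale1r scale0r add0r /X2 Om_v scalerA mulVf ?scale1r. Qed.

Lemma second_form_entries :
  [/\ h11_1 Om E p = 0, h12_1 Om T E N p = - s & h22_1 Om T E N p = - (a / w)] /\
  [/\ h11_2 Om N p = k, h12_2 Om T E N p = 0 & h22_2 Om T E N p = b / w].
Proof.
have [e11 n11] := hE X1E X1E.
have [e12 n12] := hE X1E X2E.
have [e22 n22] := hE X2E X2E.
split; split; [apply: etrans e11 _|apply: etrans e12 _|apply: etrans e22 _|
  apply: etrans n11 _|apply: etrans n12 _|apply: etrans n22 _]; ring.
Qed.

(** Up to the factor 1/4, [Delta] is the Sylvester resultant of the two components of the second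
    fundamental form. *)
Lemma DeltaE : Delta Om T E N p = - (4^-1 * (k * q)).
Proof.
have [[e11 e12 e22] [n11 n12 n22]] := second_form_entries.
rewrite /Delta e11 e12 e22 n11 n12 n22.
pose F i j := nth 0 (nth [::] [:: [:: 0; 2 * - s; - (a / w); 0]; [:: k; 2 * 0; b / w; 0];
  [:: 0; 0; 2 * - s; - (a / w)]; [:: 0; k; 2 * 0; b / w]] i) j.
by rewrite [X in _ * X](det_nat4 F) /F /q /=; ring.
Qed.

Let AmxE : Amx Om T E N p =
  entries_mx 2 3 [:: [:: 0; - s; - (a / w)]; [:: k; 0; b / w]].
Proof.
by have [[e11 e12 e22] [n11 n12 n22]] := second_form_entries; rewrite /Amx e11 e12 e22 n11 n12 n22.
Qed.

Lemma rank_Amx2 : s != 0 -> \rank (Amx Om T E N p) = 2.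
Proof.
move=> s0; apply/eqP; rewrite eqn_leq rank_leq_row/= AmxE.
set A := entries_mx _ _ _.
(* [B] selects the first two columns, whose minor is [k * s]. *)
pose B : 'M[R]_(3, 2) := \matrix_(i, j) (i == j :> nat)%:R.
apply: leq_trans (mxrankM_maxl A B).
pose F i j := nth 0 (nth [::] [:: [:: 0; - s]; [:: k; 0]] i) j.
have -> : A *m B = \matrix_(i < 2, j < 2) F i j.
  apply/matrixP => i j; rewrite !mxE !big_ord_recl big_ord0 !mxE /F.
  by case: i j => [[|[|i]]//= _] [[|[|j]]//= _]; rewrite ?mulr1 ?mulr0 ?add0r ?addr0.
rewrite mxrank_unit// unitmxE (det_nat2 F) /F/= mul0r sub0r mulNr opprK unitfE.
by rewrite mulf_neq0.
Qed.

Lemma rank_Amx1 : s = 0 -> a = 0 -> \rank (Amx Om T E N p) = 1.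
Proof.
move=> s0 a0; rewrite AmxE s0 a0 mul0r oppr0; set A := entries_mx _ _ _.
apply/eqP; rewrite eqn_leq; apply/andP; split.
  have -> : A = (\col_(i < 2) (i == 1)%:R) *m row 1 A.
    apply/matrixP => i j; rewrite !mxE big_ord_recl big_ord0 addr0 !mxE.
    case: i j => [[|[|i]]//= _] j; last by rewrite mul1r.
    by rewrite mul0r; case: j => [[|[|[|j]]]].
  exact: mulmx_max_rank.
rewrite lt0n mxrank_eq0; apply/eqP => /matrixP/(_ 1 0); rewrite !mxE /=.
by move/eqP; apply/negP.
Qed.

(** Since [w = k * k * t], the number [k * q] is [disc] times a positive square, so [Delta] has the
    sign opposite to [disc]. *)
Lemma curvature_ellipse_classification (t : R) :
  t != 0 -> w = k * k * t -> gauss_curvature Om p = b / (k * t) - s ^+ 2 ->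
  let disc := 4 * b * k * t * s ^+ 2 + a ^+ 2 in
  (0 < disc -> outside_curvature_ellipse Om p /\ hyperbolic Om T E N p) /\
  (disc < 0 -> inside_curvature_ellipse Om p /\ elliptic Om T E N p) /\
  (disc = 0 -> s != 0 -> non_degenerate Om T E N p) /\
  (disc = 0 -> s = 0 ->
     (Num.sg b = Num.sg (k * t) -> inflection_imaginary Om T E N p) /\
     (Num.sg b = - Num.sg (k * t) -> inflection_real Om T E N p) /\
     (b = 0 -> inflection_flat Om T E N p)).
Proof.
move=> t0 wE K disc; have kt0 : k * t != 0 by rewrite mulf_neq0.
have kqE : k * q = (k / w) ^+ 2 * disc.
  by rewrite /q /disc wE; move: k0 t0 => k0' t0'; field; rewrite k0' t0'.
have kw : 0 < (k / w) ^+ 2 by rewrite exprn_even_gt0// mulf_neq0 ?invr_neq0.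
have par : disc = 0 -> parabolic Om T E N p.
  by move=> d0; rewrite /parabolic DeltaE kqE d0 !mulr0 oppr0.
have KE : b / (k * t) = b * k * t / (k * t) ^+ 2.
  by move: k0 t0 => k0' t0'; field; rewrite k0' t0'.
split=> [d0|]; last split=> [d0|]; last split=> [d0 s0|d0 s0].
- split; first by apply: ellipse_outside; rewrite kqE mulr_gt0.
  by rewrite /hyperbolic DeltaE kqE oppr_lt0 mulr_gt0 ?invr_gt0// mulr_gt0.
- split; first by apply: ellipse_inside; rewrite kqE pmulr_rlt0.
  by rewrite /elliptic DeltaE kqE oppr_gt0 pmulr_rlt0 ?invr_gt0// pmulr_rlt0.
- split; [exact: par | | exact: rank_Amx2].
  (* Here [disc = 0] reads [4 * s ^+ 2 * (b * k * t) = - a ^+ 2], so the first term of the curvature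
     is at most 0 and the curvature is at most [- s ^+ 2]. *)
  have s2 : 0 < s ^+ 2 by rewrite exprn_even_gt0.
  have bkt : b * k * t <= 0.
    rewrite -(pmulr_rle0 _ s2) -(pmulr_rle0 _ (ltr0n R 4)).
    rewrite (_ : _ * _ = - a ^+ 2) ?oppr_le0 ?sqr_ge0//.
    by apply/eqP; rewrite -addr_eq0; apply/eqP; apply: etrans d0; rewrite /disc; ring.
  rewrite K KE subr_lt0 (le_lt_trans _ s2)// mulr_le0_ge0// invr_ge0 sqr_ge0.
  by [].
- have a0 : a = 0.
    apply/eqP; rewrite -sqrf_eq0; apply/eqP; apply: etrans d0.
    by rewrite /disc s0; ring.
  have {}K : gauss_curvature Om p = b / (k * t) by rewrite K s0 expr0n subr0.
  have sgK : Num.sg (gauss_curvature Om p) = Num.sg b * Num.sg (k * t).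
    by rewrite K sgrM sgrV.
  split=> [bkt|]; last split=> [bkt|b0].
  + split; first exact: par.
    by rewrite -sgr_gt0 sgK bkt -expr2 sqr_sg kt0.
  + split; [exact: par | | exact: rank_Amx1].
    by rewrite -sgr_lt0 sgK bkt mulNr -expr2 sqr_sg kt0 oppr_lt0.
  + by split; [exact: par | rewrite K b0 mul0r].
Qed.

End Point.

(** * The Gaussian curvature *)

Section Gauss.
Context {R : realType}.
Variables (U : set 'rV[R]_2) (Om T E D N : 'rV[R]_2 -> 'rV[R]_4) (W W1 W2 : 'rV[R]_2 -> R).
Hypothesis oU : open U.
Hypotheses (o : forall q, U q -> orthonormal4 (T q) (E q) (D q) (N q))
  (W0 : forall q, U q -> W q != 0)
  (Om_u : forall q, U q -> pd 0 Om q = T q)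
  (Om_v : forall q, U q -> pd 1 Om q = W q *: D q)
  (hW : has_pd U 0 W W1) (hW1 : has_pd U 0 W1 W2).

Let metricE q (Uq : U q) := metric_orthonormal (o Uq) (Om_u Uq) (Om_v Uq).
Let inv_metricE q (Uq : U q) :=
  inv_metric (o Uq) (W0 Uq) (Om_u Uq) (Om_v Uq).

Let pd_metric (l i j : 'I_2) q : U q -> pd l (fun q => metric Om q i j) q =
  if (i == 1) && (j == 1) then pd l (fun q => W q * W q) q else 0.
Proof.
move=> Uq; pose c : R := if (i == 0) && (j == 0) then 1 else 0.
have -> : pd l (fun q => metric Om q i j) q =
    pd l (fun q => if (i == 1) && (j == 1) then W q * W q else c) q.
  apply: (eq_pd oU l _ Uq) => r Ur; rewrite metricE// /c.
  by case: (i) (j) => [[|[|?]]//= _] [[|[|?]]//= _]; rewrite ?expr2.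
by case: ifP => // _; rewrite /pd derive_cst.
Qed.

Let chrE (k i j : 'I_2) q : U q -> christoffel Om k i j q =
  2^-1 * ((if k == 0 then 1 else (W q ^+ 2)^-1) *
    (pd i (fun q => metric Om q j k) q + pd j (fun q => metric Om q i k) q
     - pd k (fun q => metric Om q i j) q)).
Proof.
move=> Uq; rewrite /christoffel (bigD1 k)//= big1 ?addr0 => [|l lk].
  by rewrite inv_metricE// eqxx.
by rewrite inv_metricE// eq_sym (negPf lk) mul0r.
Qed.

Let pdWW q : U q -> pd 0 (fun q => W q * W q) q = 2 * W q * W1 q.
Proof.
by move=> Uq; have [_ ->] := has_pdM hW hW Uq; ring.
Qed.

Let chr_1_01 q : U q -> christoffel Om 1 0 1 q = W1 q / W q.
Proof.
move=> Uq; rewrite chrE// !pd_metric//= pdWW//.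
by rewrite addr0 subr0 expr2; field; exact: W0.
Qed.

Let chr_0_11 q : U q -> christoffel Om 0 1 1 q = - (W q * W1 q).
Proof. by move=> Uq; rewrite chrE// !pd_metric//= pdWW// add0r; field. Qed.

Let chr_0 i j q : U q -> ~~ ((i == 1) && (j == 1)) -> christoffel Om 0 i j q = 0.
Proof.
move=> Uq /negPf ij; rewrite chrE// !pd_metric// ij /= !andbF; ring.
Qed.

(** For the metric [du^2 + W^2 dv^2] only u-derivatives of [W] survive: the Christoffel symbol
    carrying [W_v] is multiplied by [christoffel Om 0 0 1], which is zero. The squares of [W1]
    cancel. *)
Lemma gauss_curvatureE p : U p -> gauss_curvature Om p = - W2 p / W p.
Proof.
move=> Up; have w0 := W0 Up.
have r0 : riemann Om 0 1 0 1 p = - (W p * W2 p).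
  rewrite /riemann sum_ord2 chr_1_01// chr_0_11// !chr_0// !mul0r subr0 sub0r add0r.
  have -> : pd 1 (christoffel Om 0 0 1) p = 0.
    rewrite (eq_pd oU 1 (g := fun=> 0) _ Up); first by rewrite /pd derive_cst.
    by move=> q Uq; rewrite chr_0.
  have -> : pd 0 (christoffel Om 0 1 1) p = - (W p * W2 p + W1 p * W1 p).
    rewrite (eq_pd oU 0 chr_0_11 Up).
    by have [_ ->] := has_pdN (has_pdM hW hW1) Up.
  by field.
rewrite /gauss_curvature sum_ord2 !metricE//= r0 mul1r mul0r addr0.
rewrite (det_metric (o Up) (Om_u Up) (Om_v Up)).
by field.
Qed.

End Gauss.

Theorem theorem9 (R : realType) (U : set 'rV[R]_2)
  (Om T E D N : 'rV[R]_2 -> 'rV[R]_4)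
  (U_open : open U)
  (smooth_Om : Ck 7 U Om) (smooth_E : Ck 7 U E) (smooth_D : Ck 7 U D)
  (smooth_N : Ck 7 U N)
  (Om_BDR : betchov_da_rios U Om)
  (Om_unit_speed : forall p, U p -> enorm (pd 0 Om p) = 1)
  (frame : ED2_frame U Om T E D N)
  (kappa_neq0 : forall p, U p -> kappa T N p != 0)
  (tau_neq0 : forall p, U p -> tau E N p != 0) :
  let k := kappa T N in
  let s := sigma E D in
  let t := tau E N in
  let a23 := a23 k s t in
  let a34 := a34 k s t in
  let disc := fun p => 4 * a34 p * k p * t p * s p ^+ 2 + a23 p ^+ 2 in
  forall p, U p ->
    (0 < disc p ->
       outside_curvature_ellipse Om p /\ hyperbolic Om T E N p) /\
    (disc p < 0 ->
       inside_curvature_ellipse Om p /\ elliptic Om T E N p) /\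
    (disc p = 0 -> s p != 0 -> non_degenerate Om T E N p) /\
    (disc p = 0 -> s p = 0 ->
       (Num.sg (a34 p) = Num.sg (k p * t p) ->
          inflection_imaginary Om T E N p) /\
       (Num.sg (a34 p) = - Num.sg (k p * t p) ->
          inflection_real Om T E N p) /\
       (a34 p = 0 -> inflection_flat Om T E N p)).
Proof.
move=> k s t a b disc p Up.
have eqs : ED_equations U T E D N k s t.
  exact: (frame_equations U_open smooth_Om smooth_E smooth_D smooth_N
    Om_unit_speed frame kappa_neq0).
have CT : Ck 6 U T := frame_smooth_T U_open smooth_Om frame.
have Ck_k : Ck 5 U k := frame_smooth_kappa U_open smooth_Om smooth_N frame.
have Ck6_s : Ck 6 U s.
  by apply: Ck_dot; [exact: U_open|exact: Ck_pd _ smooth_E|exact: Ck_le smooth_D].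
have Ck6_t : Ck 6 U t.
  by apply: Ck_dot; [exact: U_open|exact: Ck_pd _ smooth_E|exact: Ck_le smooth_N].
have Ck_s : Ck 5 U s := CkS Ck6_s.
have Ck_t : Ck 5 U t := CkS Ck6_t.
pose W q := k q * k q * t q.
have WE q : Wfun T E N q = W q by [].
have Om_u q : U q -> pd 0 Om q = T q by move=> Uq; rewrite (ED2_T frame Uq).
have Om_v q : U q -> pd 1 Om q = W q *: D q.
  move=> Uq; rewrite -WE; exact: (flow_velocity U_open smooth_Om smooth_E smooth_D
    smooth_N Om_unit_speed frame kappa_neq0 Om_BDR Uq).
have T_v q : U q -> pd 1 T q = pd 0 (fun q => W q *: D q) q.
  move=> Uq; rewrite -(eq_pd U_open 1 Om_u Uq).
  rewrite (pd_comm U_open 1 0 (Ck_le (k := 2) (n := 7) isT smooth_Om) Uq).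
  exact: (eq_pd U_open 0 Om_v Uq).
have o q (Uq : U q) := ED_orthonormal eqs Uq.
have oE := orthonormal4_dot (o p Up).
have aE := a23E U_open CT smooth_E smooth_D smooth_N Ck_k Ck_s Ck_t eqs
  kappa_neq0 tau_neq0 T_v Up.
have bE := a34E U_open CT smooth_E smooth_D smooth_N Ck_k Ck_s Ck_t eqs
  kappa_neq0 T_v Up.
have bD := flow_N_vD U_open CT smooth_E smooth_D smooth_N Ck_k Ck_s Ck_t eqs
  T_v Up.
rewrite -/(a p) in aE; rewrite -/(b p) in bE.
have TvE : pd 1 T p = _ *: D p - (W p * s p) *: E p :=
  flow_T_v smooth_D Ck_k Ck_t eqs T_v Up.
have w0 : Wfun T E N p != 0.
  exact: mulf_neq0 (mulf_neq0 (kappa_neq0 p Up) (kappa_neq0 p Up)) (tau_neq0 p Up).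
have hk := has_pd_Ck 0 Ck_k; have hk1 := has_pd_Ck 0 (Ck_pd 0 Ck_k).
have ht := has_pd_Ck 0 Ck_t; have ht1 := has_pd_Ck 0 (Ck_pd 0 Ck_t).
have W0 q : U q -> W q != 0 
  by move=> Uq; exact: mulf_neq0 (mulf_neq0 (kappa_neq0 q Uq) (kappa_neq0 q Uq)) (tau_neq0 q Uq).
(* In [K = - W_uu / W], the relation [flow_N_vD] replaces [W_uu] by [W s^2 - k a34]. *)
have K : gauss_curvature Om p = b p / (k p * t p) - s p ^+ 2.
  rewrite (gauss_curvatureE U_open o W0 Om_u Om_v
    (has_pd_area hk ht) (has_pd_area1 hk hk1 ht ht1) Up).
  move: bD; rewrite bE /W; have := kappa_neq0 p Up; have := tau_neq0 p Up.
  rewrite -/k -/t; move: (k p) (t p) (s p) (area2 _ _ _ _ _ _ _) (dot _ _).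
  move=> kp tp sp W2 bp t0 k0 /esym/(canRL (subrK _)) ->.
  by field; rewrite t0 k0.
have Te : pd 0 (pd 0 Om) p = k p *: N p.
  by rewrite (eq_pd U_open 0 Om_u Up) (ED_T_u eqs Up).
have Oe : pd 0 (pd 1 Om) p = pd 1 T p.
  by rewrite T_v// (eq_pd U_open 0 Om_v Up).
have dW : differentiable W p by have [] := has_pd_area hk ht Up.
have dD : differentiable D p := Ck_differentiable smooth_D Up.
have TvO : pd 1 (pd 0 Om) p = pd 1 T p by exact: (eq_pd U_open 1 Om_u Up).
(* The term in [W_v] is along [D], hence tangent; the normal components of [Om_vv] come from [D_v],
   whose [E] and [N] components follow by skew-symmetry. *)
have Ov : pd 1 (pd 1 Om) p = pd 1 W p *: D p + W p *: pd 1 D p.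
  by rewrite (eq_pd U_open 1 Om_v Up) (pdZ 1 dW dD).
have DvE : dot (pd 1 D p) (E p) = - a p.
  rewrite aE (dotC (pd 1 E p)).
  apply: (dot_pd_skew U_open 1 (c := 0)).
  - exact: Ck_differentiable smooth_D.
  - exact: Ck_differentiable smooth_E.
  - by move=> q Uq; rewrite (orthonormal4_dot (o q Uq)).
  - exact: Up.
have DvN : dot (pd 1 D p) (N p) = b p.
  rewrite bE (dotC (pd 1 N p)).
  apply: (dot_pd_skew U_open 1 (c := 0)).
  - exact: Ck_differentiable smooth_D.
  - exact: Ck_differentiable smooth_N.
  - by move=> q Uq; rewrite (orthonormal4_dot (o q Uq)).
  - exact: Up.
have He (i j : 'I_2) : dot (pd i (pd j Om) p) (E p) =
    nth 0 (nth [::] [:: [:: 0; - (Wfun T E N p * s p)];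
                        [:: - (Wfun T E N p * s p); - (Wfun T E N p * a p)]] i) j.
  move: i j; apply: ord2P; apply: ord2P => /=.
  - by rewrite Te dotZl oE mulr0.
  - by rewrite Oe TvE dotDl dotNl !dotZl !oE WE; ring.
  - by rewrite TvO TvE dotDl dotNl !dotZl !oE WE; ring.
  - by rewrite Ov dotDl !dotZl DvE oE WE; ring.
have Hn (i j : 'I_2) : dot (pd i (pd j Om) p) (N p) =
    nth 0 (nth [::] [:: [:: k p; 0]; [:: 0; Wfun T E N p * b p]] i) j.
  move: i j; apply: ord2P; apply: ord2P => /=.
  - by rewrite Te dotZl oE mulr1.
  - by rewrite Oe TvE dotDl dotNl !dotZl !oE; ring.
  - by rewrite TvO TvE dotDl dotNl !dotZl !oE; ring.
  - by rewrite Ov dotDl !dotZl DvN oE WE; ring.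
exact: (curvature_ellipse_classification (o p Up) w0 (kappa_neq0 p Up) (Om_u p Up) (Om_v p Up)
  He Hn (tau_neq0 p Up) (WE p) K).
Qed.
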